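(* Let $A$ be a locally unital graded algebra that is locally finite-dimensional and bounded below, equipped with a graded triangular basis with weight poset $\Lambda$. Assume that $A$ is unital, that $A$ is both left and right graded Noetherian, and that each of the graded algebras $A_\lambda$ $(\lambda\in\Lambda)$ has finite graded global dimension. Then $A$ has finite graded global dimension.
   Context: Conventions. $\Bbbk$ is an algebraically closed field; all algebras, categories and functors are $\Bbbk$-linear; graded means $\mathbb Z$-graded. A locally unital graded algebra is a graded associative algebra $A=\bigoplus_{i,j\in\mathbf I}1_iA1_j$ with a given family of mutually orthogonal homogeneous idempotents $1_i$ $(i\in\mathbf I)$ (possibly zero); it is unital if and only if only finitely many $1_i$ are nonzero, and then $1_A=\sum_i1_i$. $A$-gmod is the abelian category of graded left $A$-modules ($V=\bigoplus_i1_iV$) with degree-preserving homomorphisms. $A$ is locally finite-dimensional and bounded below if all $(1_iA1_j)_d$ are finite-dimensional and, for all $i,j$, $(1_iA1_j)_d=0$ for $d\ll 0$. $A$ is left (resp. right) graded Noetherian if each finitely generated projective graded left (resp. right) $A$-module satisfies the ascending chain condition on graded submodules. The left (resp. right) graded global dimension is the supremum of the projective dimensions of all graded left (resp. right) modules in the category of graded modules; for an algebra that is both left and right graded Noetherian these coincide and are called the graded global dimension. (If $A$ is left and right graded Noetherian then so is every $A_\lambda$.) Graded triangular basis. For such $A$ this is the following data: a subset $\mathbf S\subseteq\mathbf I$; a poset $(\Lambda,\leq)$ that is lower finite (each $\{\mu\in\Lambda:\mu\leq\lambda\}$ is finite); a function $\mathbf S\to\Lambda$, $s\mapsto\dot s$,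 with finite (possibly empty) fibers $\mathbf S_\lambda$; homogeneous sets $\mathrm X(i,s)\subset1_iA1_s$, $\mathrm H(s,t)\subset1_sA1_t$, $\mathrm Y(t,j)\subset1_tA1_j$ for $i,j\in\mathbf I$, $s,t\in\mathbf S$. With $\mathrm X(s)=\bigcup_i\mathrm X(i,s)$, $\mathrm Y(t)=\bigcup_j\mathrm Y(t,j)$, the axioms are: (A1) the products $xhy$ for $(x,h,y)\in\bigcup_{s,t\in\mathbf S}\mathrm X(s)\times\mathrm H(s,t)\times\mathrm Y(t)$ form a basis of $A$; (A2) $\mathrm X(s,s)=\mathrm Y(s,s)=\{1_s\}$ for $s\in\mathbf S$; (A3) for $s\neq t$ in $\mathbf S$: $\mathrm X(s,t)\neq\varnothing\Rightarrow\dot s>\dot t$, $\mathrm H(s,t)\neq\varnothing\Rightarrow\dot s=\dot t$, $\mathrm Y(s,t)\neq\varnothing\Rightarrow\dot s<\dot t$; (A4) for each $i\in\mathbf I-\mathbf S$, the sets $\{s\in\mathbf S:\mathrm X(i,s)\neq\varnothing\}$ and $\{s\in\mathbf S:\mathrm Y(s,i)\neq\varnothing\}$ are finite. The algebras $A_\lambda$. For $\lambda\in\Lambda$ let $e_\lambda=\sum_{s\in\mathbf S_\lambda}1_s$; let $A_{\geq\lambda}$ be the quotient of $A$ by the two-sided ideal generated by all $e_\mu$ with $\mu\not\geq\lambda$, let $\bar e_\lambda$ be the image of $e_\lambda$ in it, and let $A_\lambda=\bar e_\lambda A_{\geq\lambda}\bar e_\lambda$, a unital graded algebra. *)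

(* Defs.v *)
From HB Require Import structures.
From mathcomp Require Import all_boot all_order all_algebra.
From mathcomp Require Import ring_quotient generic_quotient.
From mathcomp Require Import boolp classical_sets functions cardinality fsbigop.

Set Implicit Arguments.
Unset Strict Implicit.
Unset Printing Implicit Defensive.

Import Order.TTheory GRing.Theory Num.Theory.

Local Open Scope classical_set_scope.
Local Open Scope ring_scope.

Section LinearMaps.
Variables (k : fieldType) (V W : lmodType k) (f : V -> W).
Hypothesis fL : linear f.

Lemma lin0 : f 0 = 0.
Proof. by have := fL (-1) 0 0; rewrite scaleN1r addr0 oppr0 scaleN1r addNr. Qed.

Lemma linD x y : f (x + y) = f x + f y.
Proof. by have := fL 1 x y; rewrite !scale1r. Qed.

Lemma linB x y : f (x - y) = f x - f y.
Proof. by rewrite addrC -scaleN1r fL scaleN1r addrC. Qed.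

Lemma lin_sum I (r : seq I) (P : pred I) F :
  f (\sum_(i <- r | P i) F i) = \sum_(i <- r | P i) f (F i).
Proof. exact: (big_morph f linD lin0). Qed.

End LinearMaps.

Section GradedSpaces.
Variable k : fieldType.

(* A Z-grading V = (+)_d V_d, given by its projections: [hc d v] is the
   component of [v] of degree [d], and V_d = [set v | hc d v = v]. *)
Record grading (V : lmodType k) := Grading {
  hc : int -> V -> V;
  hcL : forall d, linear (hc d);
  hcK : forall d e v, hc d (hc e v) = if d == e then hc e v else 0;
  hc_sum : forall v, exists2 s : seq int, uniq s & v = \sum_(d <- s) hc d v }.

Definition has_degree (V : lmodType k) (G : grading V) (d : int) : set V :=
  [set v | hc G d v = v].

Definition homogeneous (V : lmodType k) (G : grading V) : set V :=
  [set v | exists d, has_degree G d v].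

Definition submodule (V : lmodType k) (U : set V) : Prop :=
  U 0 /\ forall (c : k) u v, U u -> U v -> U (c *: u + v).

Definition finite_dimensional (V : lmodType k) (U : set V) : Prop :=
  exists2 s : seq V, [set` s] `<=` U &
    forall u, U u -> exists c : V -> k, u = \sum_(v <- s) c v *: v.

Definition is_basis (J : choiceType) (D : set J) (V : lmodType k) (f : J -> V) :
    Prop :=
  (forall (s : seq J) (c : J -> k), uniq s -> [set` s] `<=` D ->
     \sum_(j <- s) c j *: f j = 0 -> forall j, j \in s -> c j = 0) /\
  (forall v, exists (s : seq J) (c : J -> k),
     [set` s] `<=` D /\ v = \sum_(j <- s) c j *: f j).

(* Locally unital graded algebras; [gone i] is the idempotent 1_i.  The sum of
   the 1_i A 1_j is automatically direct since the 1_i are orthogonal. *)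
Record lugalg := LUGAlg {
  idx : choiceType;
  gsort :> lmodType k;
  gmul : gsort -> gsort -> gsort;
  gone : idx -> gsort;
  ggr : grading gsort;
  gmulL : forall a, linear (gmul a);
  gmulR : forall b, linear (gmul^~ b);
  gmulA : associative gmul;
  gmul_deg : forall d e a b, has_degree ggr d a -> has_degree ggr e b ->
    has_degree ggr (d + e) (gmul a b);
  gone_homogeneous : forall i, homogeneous ggr (gone i);
  gone_orth : forall i j, gmul (gone i) (gone j) = if i == j then gone i else 0;
  gone_sum : forall a, exists2 s : seq idx, uniq s &
    a = \sum_(i <- s) \sum_(j <- s) gmul (gmul (gone i) a) (gone j) }.

End GradedSpaces.

Arguments gone {k} _ _.
Arguments ggr {k} _.
Arguments idx {k} _.

Notation "a ⋆ b" := (gmul a b) (at level 40, left associativity).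

Section Algebras.
Variables (k : fieldType).
Implicit Type A : lugalg k.

(* 1_i A 1_j *)
Definition piece A (i j : idx A) : set A :=
  [set gone A i ⋆ a ⋆ gone A j | a in [set: A]].

Definition locally_finite_dimensional A : Prop :=
  forall i j d, finite_dimensional (piece i j `&` has_degree (ggr A) d).

Definition bounded_below A : Prop :=
  forall i j : idx A, exists N : int, forall d : int, d < N ->
    piece i j `&` has_degree (ggr A) d `<=` [set 0].

Definition unital A : Prop :=
  exists u : A, forall a : A, u ⋆ a = a /\ a ⋆ u = a.

Lemma opp_deg A d e (a b : A) : has_degree (ggr A) d a ->
  has_degree (ggr A) e b -> has_degree (ggr A) (d + e) (b ⋆ a).
Proof. by move=> da eb; rewrite addrC; exact: gmul_deg. Qed.

Lemma opp_orth A i j : gone A j ⋆ gone A i = if i == j then gone A i else 0.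
Proof. by rewrite gone_orth eq_sym; case: eqP => // ->. Qed.

Lemma opp_sum A (a : A) : exists2 s : seq (idx A), uniq s &
  a = \sum_(i <- s) \sum_(j <- s) gone A j ⋆ (a ⋆ gone A i).
Proof.
have [s us {1}->] := gone_sum a; exists s => //.
by rewrite exchange_big; do 2!(apply: eq_bigr => ? _); rewrite gmulA.
Qed.

Definition oppalg A : lugalg k := LUGAlg (gmul := fun a b : A => b ⋆ a)
  (@gmulR _ A) (@gmulL _ A) (fun a b c => esym (gmulA c b a)) (@opp_deg A)
  (@gone_homogeneous _ A) (@opp_orth A) (@opp_sum A).

(* Graded left A-modules V = (+)_i 1_i V; a degree-preserving homomorphism is
   an A-linear map commuting with the degree components. *)
Record gmod A := GMod {
  msort :> lmodType k;
  mact : A -> msort -> msort;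
  mgr : grading msort;
  mactL : forall a, linear (mact a);
  mactR : forall v, linear (mact^~ v);
  mactA : forall a b v, mact (a ⋆ b) v = mact a (mact b v);
  mact_deg : forall d e a v, has_degree (ggr A) d a -> has_degree mgr e v ->
    has_degree mgr (d + e) (mact a v);
  mact_sum : forall v, exists2 s : seq (idx A), uniq s &
    v = \sum_(i <- s) mact (gone A i) v }.

Record ghom A (M N : gmod A) := GHom {
  hfun :> M -> N;
  hfunL : linear hfun;
  hfun_act : forall a v, hfun (mact a v) = mact a (hfun v);
  hfun_deg : forall d v, hfun (hc (mgr M) d v) = hc (mgr N) d (hfun v) }.

Definition surjective A (M N : gmod A) (f : ghom M N) : Prop :=
  forall y, exists x, f x = y.

Definition projective A (P : gmod A) : Prop :=
  forall (M N : gmod A) (g : ghom M N) (f : ghom P N), surjective g ->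
    exists h : ghom P M, forall x, g (h x) = f x.

Definition graded_submodule A (M : gmod A) (U : set M) : Prop :=
  [/\ submodule U, forall a v, U v -> U (mact a v) &
      forall d v, U v -> U (hc (mgr M) d v)].

Definition finitely_generated A (M : gmod A) : Prop :=
  exists s : seq M, forall v, exists c : M -> A, v = \sum_(m <- s) mact (c m) m.

Definition graded_acc A (M : gmod A) : Prop :=
  forall U : nat -> set M, (forall n, graded_submodule (U n)) ->
    (forall n, U n `<=` U n.+1) ->
    exists n, forall m, (n <= m)%N -> U m = U n.

Definition left_graded_noetherian A : Prop :=
  forall P : gmod A, finitely_generated P -> projective P -> graded_acc P.

(* Graded right A-modules are graded left modules over the opposite algebra. *)
Definition right_graded_noetherian A : Prop :=
  left_graded_noetherian (oppalg A).

(* There is an exact sequence 0 -> P_n -> ... -> P_0 -> M -> 0 in which all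
   the P_i are projective. *)
Definition projdim_le A (M : gmod A) (n : nat) : Prop :=
  exists (P : nat -> gmod A) (d : forall i, ghom (P i.+1) (P i))
         (eps : ghom (P 0) M),
    [/\ forall i, projective (P i),
        forall i, (n < i)%N -> forall x : P i, x = 0,
        surjective eps,
        forall x, eps x = 0 <-> exists y, d 0 y = x &
        forall i x, d i x = 0 <-> exists y, d i.+1 y = x].

(* The supremum of the projective dimensions is at most n. *)
Definition left_gldim_le A (n : nat) : Prop :=
  forall M : gmod A, projdim_le M n.

Definition right_gldim_le A (n : nat) : Prop := left_gldim_le (oppalg A) n.

(* For left and right graded Noetherian algebras the two one-sided dimensions
   agree, and the graded global dimension is their common value. *)
Definition finite_graded_gldim A : Prop :=
  exists n, left_gldim_le A n /\ right_gldim_le A n.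

Definition two_sided_ideal A (J : set A) : Prop :=
  submodule J /\ forall a b, J b -> J (a ⋆ b) /\ J (b ⋆ a).

Definition ideal_gen A (E : set A) : set A :=
  \bigcap_(J in [set J | two_sided_ideal J /\ E `<=` J]) J.

Record graded_ideal A := GradedIdeal {
  iset : set A;
  iset_ideal : two_sided_ideal iset;
  iset_hc : forall d a, iset a -> iset (hc (ggr A) d a) }.

Lemma deg_eq (V : lmodType k) (G : grading V) d e v :
  has_degree G e v -> hc G d v = if d == e then v else 0.
Proof. by move=> gv; rewrite -{1}gv hcK gv. Qed.

Lemma hc_gmul A d (a b : A) s : uniq s -> a = \sum_(e <- s) hc (ggr A) e a ->
  hc (ggr A) d (a ⋆ b) =
  \sum_(e <- s) hc (ggr A) e a ⋆ hc (ggr A) (d - e) b.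
Proof.
move=> us sa; rewrite {1}sa (lin_sum (gmulR b)) (lin_sum (hcL _ d)).
apply: eq_bigr => e _; have [t ut tb] := hc_sum (ggr A) b.
rewrite {1 2}tb (lin_sum (gmulL _)) !(lin_sum (hcL _ _)) (lin_sum (gmulL _)).
apply: eq_bigr => f _; rewrite (@deg_eq _ _ _ (e + f)); last first.
  by apply: gmul_deg; rewrite /has_degree /= hcK eqxx.
by rewrite hcK subr_eq addrC; case: eqP => // _; rewrite (lin0 (gmulL _)).
Qed.

Lemma idem_deg0 A (e : A) : e ⋆ e = e -> homogeneous (ggr A) e ->
  has_degree (ggr A) 0 e.
Proof.
move=> ee [d de]; have := gmul_deg de de; rewrite ee => dde.
rewrite /has_degree /= (deg_eq _ de).
case: eqP => // /eqP d0; move: dde; rewrite /has_degree /= (deg_eq _ de).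
by rewrite -subr_eq0 addrK eq_sym (negbTE d0).
Qed.

Lemma ideal_genP A (E : set A) : two_sided_ideal (ideal_gen E).
Proof.
split; first split.
- by move=> J /= [[[J0 _] _] _].
- move=> c u v Eu Ev J JE; case: (JE) => -[[_ JL] _] _.
  by apply: JL; [exact: Eu | exact: Ev].
- by move=> a b Eb; split=> J JE; case: (JE) => -[_ /(_ a b)] JM _;
    have [] := JM (Eb _ JE).
Qed.

Lemma ideal_gen_hc A (E : set A) : E `<=` homogeneous (ggr A) ->
  forall d a, ideal_gen E a -> ideal_gen E (hc (ggr A) d a).
Proof.
move=> Eh d a Ea.
suff : [set a | forall d, ideal_gen E (hc (ggr A) d a)] a by apply.
have [[J0 JL] JM] := ideal_genP E.
have Jsum I (r : seq I) (F : I -> A) : (forall i, ideal_gen E (F i)) ->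
    ideal_gen E (\sum_(i <- r) F i).
  move=> JF; apply: big_ind => // x y Jx Jy.
  by have := JL 1 _ _ Jx Jy; rewrite scale1r.
apply: Ea; split; first split; first split.
- by move=> e; rewrite (lin0 (hcL _ _)).
- by move=> c u v Eu Ev e; rewrite hcL; apply: JL.
- move=> u v Jv; split=> e.
    have [s us su] := hc_sum (ggr A) u; rewrite (hc_gmul _ _ us su).
    by apply: Jsum => f; have [] := JM (hc (ggr A) f u) _ (Jv (e - f)).
  have [s us sv] := hc_sum (ggr A) v; rewrite (hc_gmul _ _ us sv).
  by apply: Jsum => f; have [] := JM (hc (ggr A) (e - f) u) _ (Jv f).
- move=> x Ex e; have [f fx] := Eh x Ex; rewrite (deg_eq _ fx).
  by case: eqP => // _ J [_]; apply.
Qed.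

Definition graded_ideal_gen A (E : set A) (Eh : E `<=` homogeneous (ggr A)) :
    graded_ideal A :=
  GradedIdeal (ideal_genP E) (ideal_gen_hc Eh).

Definition imem A (J : graded_ideal A) : {pred A} := fun a => `[< iset J a >].

End Algebras.

Section Quotient.
Variables (k : fieldType) (A : lugalg k) (J : graded_ideal A).

Lemma imem_submod : submod_closed (imem J).
Proof.
have [[J0 JL] _] := iset_ideal J; split; first exact/asboolP.
by move=> c u v /asboolP Ju /asboolP Jv; apply/asboolP/JL.
Qed.

HB.instance Definition _ := GRing.isSubmodClosed.Build k A (imem J) imem_submod.

Definition qsort : Type := Quotient.quot (imem J).
HB.instance Definition _ := GRing.Zmodule.on qsort.

Definition qpi (a : A) : qsort := \pi_(Quotient.quot (imem J))%qT a.
Definition qrepr (x : qsort) : A := repr x.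

Lemma qreprK x : qpi (qrepr x) = x.
Proof. exact: reprK. Qed.

Lemma qpiD a b : qpi (a + b) = qpi a + qpi b.
Proof. exact: raddfD. Qed.

Lemma qpiP a b : qpi a = qpi b <-> iset J (a - b).
Proof.
rewrite /qpi; split=> [/eqP|Jab]; last apply/eqP.
  by rewrite -Quotient.idealrBE => /asboolP.
by rewrite -Quotient.idealrBE; apply/asboolP.
Qed.

Lemma qreprB a : iset J (qrepr (qpi a) - a).
Proof. by apply/qpiP; rewrite qreprK. Qed.

Definition qscale (c : k) (x : qsort) : qsort := qpi (c *: qrepr x).

Lemma qpiZ c a : qpi (c *: a) = qscale c (qpi a).
Proof.
apply/esym/qpiP; rewrite -scalerBr -[_ *: _]addr0.
by have [[J0 JL] _] := iset_ideal J; apply: JL; first exact: qreprB.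
Qed.

Lemma qscaleA c d x : qscale c (qscale d x) = qscale (c * d) x.
Proof. by rewrite -(qreprK x) -!qpiZ scalerA. Qed.
Lemma qscale1 : left_id 1 qscale.
Proof. by move=> x; rewrite -(qreprK x) -qpiZ scale1r. Qed.
Lemma qscaleDr : right_distributive qscale +%R.
Proof.
move=> c x y; rewrite -(qreprK x) -(qreprK y) -qpiD -!qpiZ.
by rewrite scalerDr qpiD.
Qed.
Lemma qscaleDl x : {morph qscale^~ x : c d / c + d}.
Proof. by move=> c d; rewrite -(qreprK x) -!qpiZ scalerDl qpiD. Qed.

HB.instance Definition _ :=
  GRing.Zmodule_isLmodule.Build k qsort qscaleA qscale1 qscaleDr qscaleDl.

Lemma qpiL : linear qpi.
Proof. by move=> c u v; rewrite qpiD qpiZ. Qed.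

Definition qhc (d : int) (x : qsort) : qsort := qpi (hc (ggr A) d (qrepr x)).
Definition qmul (x y : qsort) : qsort := qpi (qrepr x ⋆ qrepr y).

Lemma qhcE d a : qhc d (qpi a) = qpi (hc (ggr A) d a).
Proof.
by apply/qpiP; rewrite -(linB (hcL _ _)); exact/iset_hc/qreprB.
Qed.

Lemma qmulE a b : qmul (qpi a) (qpi b) = qpi (a ⋆ b).
Proof.
have [[_ JL] JM] := iset_ideal J.
apply/qpiP; set a' := qrepr _; set b' := qrepr _.
have -> : a' ⋆ b' - a ⋆ b = 1 *: ((a' - a) ⋆ b') + a ⋆ (b' - b).
  by rewrite scale1r (linB (gmulR _)) (linB (gmulL _)) subrKA.
by apply: JL; [have [] := JM b' _ (qreprB a) | have [] := JM a _ (qreprB b)].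
Qed.

Lemma qhcL d : linear (qhc d).
Proof.
move=> c x y; rewrite -(qreprK x) -(qreprK y) -qpiL !qhcE.
by rewrite hcL qpiL.
Qed.

Lemma qhcK d e x : qhc d (qhc e x) = if d == e then qhc e x else 0.
Proof.
rewrite -(qreprK x) !qhcE hcK; case: eqP => // _.
exact: (lin0 qpiL).
Qed.

Lemma qhc_sum x : exists2 s : seq int, uniq s & x = \sum_(d <- s) qhc d x.
Proof.
have [s us sx] := hc_sum (ggr A) (qrepr x); exists s => //.
by rewrite -{1}(qreprK x) sx (lin_sum qpiL).
Qed.

Definition qgr : grading qsort := Grading qhcL qhcK qhc_sum.

Lemma qmulL x : linear (qmul x).
Proof.
move=> c y z; rewrite -(qreprK x) -(qreprK y) -(qreprK z).
by rewrite -qpiL !qmulE gmulL qpiL.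
Qed.

Lemma qmulR y : linear (qmul^~ y).
Proof.
move=> c x z; rewrite -(qreprK x) -(qreprK y) -(qreprK z).
by rewrite -qpiL !qmulE gmulR qpiL.
Qed.

Lemma qmulA : associative qmul.
Proof.
move=> x y z; rewrite -(qreprK x) -(qreprK y) -(qreprK z).
by rewrite !qmulE gmulA.
Qed.

Lemma qpi_deg d a : has_degree (ggr A) d a -> has_degree qgr d (qpi a).
Proof. by rewrite /has_degree /= qhcE => ->. Qed.

Lemma qmul_deg d e x y : has_degree qgr d x -> has_degree qgr e y ->
  has_degree qgr (d + e) (qmul x y).
Proof.
move=> <- <-; rewrite qmulE; apply: qpi_deg.
by apply: gmul_deg; rewrite /has_degree /= hcK eqxx.
Qed.

Lemma qone_homogeneous i : homogeneous qgr (qpi (gone A i)).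
Proof. by have [d ?] := gone_homogeneous i; exists d; apply: qpi_deg. Qed.

Lemma qone_orth i j :
  qmul (qpi (gone A i)) (qpi (gone A j)) = if i == j then qpi (gone A i) else 0.
Proof.
by rewrite qmulE gone_orth; case: eqP => // _; exact: (lin0 qpiL).
Qed.

Lemma qone_sum x : exists2 s : seq (idx A), uniq s & x =
  \sum_(i <- s) \sum_(j <- s) qmul (qmul (qpi (gone A i)) x) (qpi (gone A j)).
Proof.
have [s us sx] := gone_sum (qrepr x); exists s => //.
rewrite -{1}(qreprK x) sx (lin_sum qpiL); apply: eq_bigr => i _.
rewrite (lin_sum qpiL); apply: eq_bigr => j _.
by rewrite -{2}(qreprK x) !qmulE.
Qed.

Definition quotalg : lugalg k := LUGAlg qmulL qmulR qmulA qmul_deg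
  qone_homogeneous qone_orth qone_sum.

End Quotient.

Section Corner.
Variables (k : fieldType) (B : lugalg k) (e : B).
Hypotheses (ee : e ⋆ e = e) (eh : homogeneous (ggr B) e).

Definition cmem : {pred B} := fun b => e ⋆ b ⋆ e == b.

Lemma cmem_submod : submod_closed cmem.
Proof.
split=> [|c u v]; rewrite /in_mem /= /cmem.
  by rewrite (lin0 (gmulL _)) (lin0 (gmulR _)).
by move=> /eqP eu /eqP ev; rewrite gmulL gmulR eu ev.
Qed.

HB.instance Definition _ := GRing.isSubmodClosed.Build k B cmem cmem_submod.

(* The corner eBe = {b | ebe = b}, with identity element e. *)
Definition csort : Type := {b : B | cmem b}.
HB.instance Definition _ := SubType.copy csort {b : B | cmem b}.
HB.instance Definition _ := Choice.copy csort {b : B | cmem b}.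
HB.instance Definition _ := [SubChoice_isSubLmodule of csort by <:].

Lemma cmemP (x : csort) : e ⋆ val x ⋆ e = val x.
Proof. exact/eqP/(valP x). Qed.

Lemma cmemL (x : csort) : e ⋆ val x = val x.
Proof. by rewrite -cmemP !gmulA ee. Qed.

Lemma cmemR (x : csort) : val x ⋆ e = val x.
Proof. by rewrite -cmemP -!gmulA ee. Qed.

Lemma hc_corner d (b : B) :
  hc (ggr B) d (e ⋆ b ⋆ e) = e ⋆ hc (ggr B) d b ⋆ e.
Proof.
have e0 := idem_deg0 ee eh.
have [s us sb] := hc_sum (ggr B) b.
rewrite {1 2}sb (lin_sum (gmulL _)) (lin_sum (gmulR _)).
rewrite !(lin_sum (hcL _ _)) (lin_sum (gmulL _)) (lin_sum (gmulR _)).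
apply: eq_bigr => f _; rewrite (@deg_eq _ _ _ _ f) ?hcK.
  by case: eqP => // _; rewrite (lin0 (gmulL _)) (lin0 (gmulR _)).
have fb : has_degree (ggr B) f (hc (ggr B) f b).
  by rewrite /has_degree /= hcK eqxx.
by have := gmul_deg (gmul_deg e0 fb) e0; rewrite add0r addr0.
Qed.

Lemma chc_mem d (x : csort) : cmem (hc (ggr B) d (val x)).
Proof. by rewrite /cmem -hc_corner cmemP. Qed.

Lemma cmul_mem (x y : csort) : cmem (val x ⋆ val y).
Proof. by rewrite /cmem gmulA cmemL -gmulA cmemR. Qed.

Lemma cone_mem : cmem e.
Proof. by rewrite /cmem !ee. Qed.

Definition chc d (x : csort) : csort := Sub _ (chc_mem d x).
Definition cmul (x y : csort) : csort := Sub _ (cmul_mem x y).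
Definition cone : csort := Sub _ cone_mem.

Lemma valL (c : k) (x y : csort) : val (c *: x + y) = c *: val x + val y.
Proof. by []. Qed.

Lemma chcL d : linear (chc d).
Proof. by move=> c x y; apply/val_inj; rewrite valL /= hcL. Qed.

Lemma chcK d f x : chc d (chc f x) = if d == f then chc f x else 0.
Proof. by apply/val_inj; rewrite /= hcK; case: eqP. Qed.

Lemma chc_sum x : exists2 s : seq int, uniq s & x = \sum_(d <- s) chc d x.
Proof.
have [s us sx] := hc_sum (ggr B) (val x); exists s => //.
by apply/val_inj; rewrite raddf_sum.
Qed.

Definition cgr : grading csort := Grading chcL chcK chc_sum.

Lemma cmulL x : linear (cmul x).
Proof. by move=> c y z; apply/val_inj; rewrite valL /= gmulL. Qed.

Lemma cmulR y : linear (cmul^~ y).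
Proof. by move=> c x z; apply/val_inj; rewrite valL /= gmulR. Qed.

Lemma cmulA : associative cmul.
Proof. by move=> x y z; apply/val_inj; rewrite /= gmulA. Qed.

Lemma cdegE d x : has_degree cgr d x <-> has_degree (ggr B) d (val x).
Proof.
by split=> [/(congr1 val)//|dx]; apply/val_inj.
Qed.

Lemma cmul_deg d f x y : has_degree cgr d x -> has_degree cgr f y ->
  has_degree cgr (d + f) (cmul x y).
Proof. by move=> /cdegE dx /cdegE fy; apply/cdegE; exact: gmul_deg. Qed.

Lemma cone_homogeneous (i : unit) : homogeneous cgr cone.
Proof. by have [d ed] := eh; exists d; apply/cdegE. Qed.

Lemma cone_orth (i j : unit) : cmul cone cone = if i == j then cone else 0.
Proof. by case: i; case: j; apply/val_inj; rewrite /= ee. Qed.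

Lemma cone_sum x : exists2 s : seq unit, uniq s &
  x = \sum_(i <- s) \sum_(j <- s) cmul (cmul cone x) cone.
Proof.
by exists [:: tt] => //; rewrite !big_seq1; apply/val_inj; rewrite /= cmemP.
Qed.

Definition corner : lugalg k := LUGAlg cmulL cmulR cmulA cmul_deg
  cone_homogeneous cone_orth cone_sum.

End Corner.

Section TriangularBasis.
Variable k : fieldType.

(* [tX i s], [tH s t], [tY t j] are the sets X(i,s), H(s,t), Y(t,j), and [val s]
   is s : tS seen in the index set.  In [tA1] the basis is the family of products
   xhy indexed by the triples (x, h, y), so distinct triples have distinct
   products. *)
Record triangular_basis (A : lugalg k) (disp : Order.disp_t)
    (L : porderType disp) := TriangularBasis {
  tS : set (idx A);
  dot : tS -> L;
  tX : idx A -> tS -> set A;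
  tH : tS -> tS -> set A;
  tY : tS -> idx A -> set A;
  weight_lower_finite : forall l : L, finite_set [set m : L | m <= l]%O;
  fiber_finite : forall l, finite_set [set s | dot s = l];
  tX_sub : forall i s, tX i s `<=` piece i (val s) `&` homogeneous (ggr A);
  tH_sub : forall s t, tH s t `<=` piece (val s) (val t) `&` homogeneous (ggr A);
  tY_sub : forall t j, tY t j `<=` piece (val t) j `&` homogeneous (ggr A);
  tA1 : is_basis
    [set p : A * A * A | exists s t : tS,
       [/\ exists i, tX i s p.1.1, tH s t p.1.2 & exists j, tY t j p.2]]
    (fun p : A * A * A => p.1.1 ⋆ p.1.2 ⋆ p.2);
  tA2 : forall s : tS, tX (val s) s = [set gone A (val s)] /\
                       tY s (val s) = [set gone A (val s)];
  tA3 : forall s t : tS, s <> t ->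
    [/\ tX (val s) t !=set0 -> (dot t < dot s)%O,
        tH s t !=set0 -> dot s = dot t &
        tY s (val t) !=set0 -> (dot s < dot t)%O];
  tA4 : forall i : idx A, ~ tS i ->
    finite_set [set s | tX i s !=set0] /\ finite_set [set s | tY s i !=set0] }.

Variables (A : lugalg k) (disp : Order.disp_t) (L : porderType disp).
Variable T : triangular_basis A L.

(* e_l *)
Definition e_weight (l : L) : A :=
  \sum_(s \in [set s : tS T | dot s = l]) gone A (val s).

Lemma gone_deg0 i : has_degree (ggr A) 0 (gone A i).
Proof.
by apply: idem_deg0 (gone_homogeneous i); rewrite gone_orth eqxx.
Qed.

Lemma e_weight_deg0 l : has_degree (ggr A) 0 (e_weight l).
Proof.
rewrite /has_degree /= (lin_sum (hcL _ _)).
by apply: eq_bigr => s _; exact: gone_deg0.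
Qed.

Lemma e_weight_idem l : e_weight l ⋆ e_weight l = e_weight l.
Proof.
rewrite {1 3}/e_weight (lin_sum (gmulR _)).
rewrite big_seq [RHS]big_seq; apply: eq_bigr => s sl.
rewrite (lin_sum (gmulL _)) (bigD1_seq s) ?finite_support_uniq //=.
rewrite gone_orth eqxx big1 ?addr0 // => t /negPf ts.
by rewrite gone_orth (inj_eq val_inj) eq_sym ts.
Qed.

(* The e_m with m not >= l. *)
Definition e_not_above (l : L) : set A :=
  [set e_weight m | m in [set m | ~~ (l <= m)%O]].

Lemma e_not_above_homogeneous l : e_not_above l `<=` homogeneous (ggr A).
Proof. by move=> _ [m _ <-]; exists 0; exact: e_weight_deg0. Qed.

Definition ideal_not_above (l : L) : graded_ideal A :=
  graded_ideal_gen (@e_not_above_homogeneous l).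

(* A_{>= l} *)
Definition alg_ge (l : L) : lugalg k := quotalg (ideal_not_above l).

Definition ebar (l : L) : alg_ge l := qpi (ideal_not_above l) (e_weight l).

Lemma ebar_idem l : ebar l ⋆ ebar l = ebar l.
Proof. by rewrite /= qmulE e_weight_idem. Qed.

Lemma ebar_homogeneous l : homogeneous (ggr (alg_ge l)) (ebar l).
Proof. by exists 0; apply: qpi_deg; exact: e_weight_deg0. Qed.

(* A_l = ebar_l A_{>= l} ebar_l *)
Definition alg_weight (l : L) : lugalg k :=
  corner (@ebar_idem l) (@ebar_homogeneous l).

End TriangularBasis.

(* Main.v *)
From HB Require Import structures.
From mathcomp Require Import all_boot all_order all_algebra.
From mathcomp Require Import ring_quotient generic_quotient.
From mathcomp Require Import boolp classical_sets functions cardinality fsbigop.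
Require Import Defs.

(** Finite global dimension is bounded by layers, one for each weight.

    For a set [G] of weights let [J_G] be the span of the basis elements [x h y]
    of weight in [G].  Triangularity makes [J_G] a two-sided ideal when [G] is a
    lower set ([gone_wspan], [wspan_mull], [wspan_mulr]).  As [A] is unital, its
    unit lies in [J_G] for some finite lower set [G] ([wspan_filtered]), and then
    only the zero module is killed by [J_G].  Removing the weights of [G] one by
    one, maximal ones first, it suffices to show: if [l] is minimal outside the
    lower set [G], and the modules killed by [J_G] and by [e_l] have bounded
    projective dimension, then so have the modules killed by [J_G] ([pd_layer]).

    Let [M] be killed by [J_G].  The corner [e_l M] is a module over [A_l], since
    [J_G] and the ideal defining [A_l] have the same trace on [e_l A e_l]
    ([weight_corner_map]).  One argues by induction on the projective dimension of
    [e_l M] over [A_l] ([pd_corner]).  Let [Q] be a sum of shifts of the modules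
    [A 1_s / J_G 1_s] with [dot s = l], mapping onto [A e_l M].  Then [e_l Q] is
    projective and covers [e_l M], so passing from [M] to the kernel of [Q -> M]
    replaces [e_l M] by a syzygy.  When [e_l M] is itself projective, the cover
    [e_l Q -> e_l M] splits, and the resulting idempotent of [e_l Q] extends to
    [Q]; its image [X] is a summand of [Q] such that the kernel and the cokernel
    of [X -> M] are killed by [e_l] ([pd_projective_corner]).  This replaces the
    tensor products with standard modules by idempotents.

    The remaining input is a bound for the projective dimension of [Q]
    ([pd_mod_coef]).  By linear independence of the products [x h y], the layer of
    weight [l] in a sum of modules [A 1_i / J_G 1_i] is the direct sum, over the
    [y] of weight [l], of shifts of modules [A 1_t / J_G 1_t] ([layer_map]); so
    each weight raises the dimension by at most one.

    All this concerns left modules.  The right modules are the left modules over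
    the opposite algebra, which has the opposite triangular basis, with the roles
    of the [x] and the [y] exchanged ([opp_basis]), and whose weight algebras can
    be taken to be the opposites of the [A_l] ([corner_map_opp]).

    Projective dimension is handled through its first step, by recursion ([pd]):
    Schanuel's lemma [pd_cover] and the long exact sequence estimates [pd_ext] and
    [pd_quot] are all derived from pullbacks. *)

Set Implicit Arguments.
Unset Strict Implicit.
Unset Printing Implicit Defensive.

Import Order.TTheory GRing.Theory Num.Theory.

Local Open Scope classical_set_scope.
Local Open Scope ring_scope.

(** * Submodules, quotients and direct sums of graded modules *)

Section FiniteDecompositions.
Variables (k : fieldType) (I : choiceType) (V : lmodType k) (p : I -> V -> V).
Hypothesis pL : forall i, linear (p i).
Hypothesis pK : forall i j v, p i (p j v) = if i == j then p j v else 0.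

(** Vectors that are finite sums of their components under a family of
    orthogonal projections.  Both the grading condition and the local unit
    condition on a module have this shape. *)
Definition decomposable (v : V) : Prop :=
  exists2 s : seq I, uniq s & v = \sum_(i <- s) p i v.

Lemma decomposable_notin s v i : v = \sum_(j <- s) p j v -> i \notin s ->
  p i v = 0.
Proof.
move=> -> si; rewrite (lin_sum (pL _)) big_seq big1 // => j js.
by rewrite pK; case: eqP => // ij; move: si; rewrite ij js.
Qed.

Lemma decomposable_sub s t v : uniq s -> v = \sum_(i <- s) p i v -> uniq t ->
  {subset s <= t} -> v = \sum_(i <- t) p i v.
Proof.
move=> us sv ut st; rewrite {1}sv [RHS](bigID (fun i => i \in s)) /=.
rewrite [X in _ + X]big1 ?addr0; last first.
  by move=> i si; exact: decomposable_notin sv si.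
rewrite -[RHS]big_filter; apply: perm_big; apply: uniq_perm => //.
  exact: filter_uniq.
move=> i; rewrite mem_filter; case: (boolP (i \in s)) => //= si.
by rewrite st.
Qed.

Lemma decomposable0 : decomposable 0.
Proof. by exists [::] => //; rewrite big_nil. Qed.

Lemma decomposableL c u v : decomposable u -> decomposable v ->
  decomposable (c *: u + v).
Proof.
move=> [s us su] [t ut tv]; set r := undup (s ++ t).
have ur : uniq r by exact: undup_uniq.
exists r => //.
have {1}-> : u = \sum_(i <- r) p i u.
  by apply: decomposable_sub us su ur _ => i; rewrite mem_undup mem_cat => ->.
have {1}-> : v = \sum_(i <- r) p i v.
  apply: decomposable_sub ut tv ur _ => i.
  by rewrite mem_undup mem_cat orbC => ->.
rewrite scaler_sumr -big_split /=; apply: eq_bigr => i _.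
by rewrite pL.
Qed.

End FiniteDecompositions.

Section Basics.
Variables (k : fieldType).

Lemma linZ (V W : lmodType k) (f : V -> W) : linear f ->
  forall c x, f (c *: x) = c *: f x.
Proof. by move=> fL c x; have := fL c x 0; rewrite (lin0 fL) !addr0. Qed.

Lemma submoduleD (V : lmodType k) (U : set V) u v : submodule U ->
  U u -> U v -> U (u + v).
Proof. by move=> [_ UL] Uu Uv; rewrite -[u]scale1r; exact: UL. Qed.

Lemma submoduleZ (V : lmodType k) (U : set V) c u : submodule U ->
  U u -> U (c *: u).
Proof. by move=> [U0 UL] Uu; rewrite -[_ *: _]addr0; exact: UL. Qed.

Lemma submoduleB (V : lmodType k) (U : set V) u v : submodule U ->
  U u -> U v -> U (u - v).
Proof.
by move=> [_ UL] Uu Uv; rewrite addrC -scaleN1r; exact: UL.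
Qed.

Lemma submodule_sum (V : lmodType k) (U : set V) : submodule U ->
  forall I (r : seq I) (P : pred I) F, (forall i, P i -> U (F i)) ->
  U (\sum_(i <- r | P i) F i).
Proof.
move=> HU I r P F UF; elim/big_ind : _ => //; first by case: HU.
by move=> ? ?; apply: submoduleD.
Qed.

Lemma submodule_sum_seq (V : lmodType k) (U : set V) : submodule U ->
  forall (I : eqType) (r : seq I) F, (forall i, i \in r -> U (F i)) ->
  U (\sum_(i <- r) F i).
Proof. by move=> HU I r F UF; rewrite big_seq; apply: submodule_sum. Qed.

Variable (A : lugalg k).

Lemma gone_idem i : gone A i ⋆ gone A i = gone A i.
Proof. by rewrite gone_orth eqxx. Qed.

Lemma hcKd (V : lmodType k) (G : grading V) d v : has_degree G d (hc G d v).
Proof. by rewrite /has_degree /= hcK eqxx. Qed.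

Lemma mact_gone (M : gmod A) i j (v : M) :
  mact (gone A i) (mact (gone A j) v) =
  if i == j then mact (gone A j) v else 0.
Proof.
rewrite -mactA gone_orth; case: eqP => [->|_] //.
by rewrite (lin0 (mactR v)).
Qed.

Lemma gone_mull (i j : idx A) (a : A) :
  gone A i ⋆ (gone A j ⋆ a) = if i == j then gone A j ⋆ a else 0.
Proof.
rewrite gmulA gone_orth; case: eqP => [->|_] //.
by rewrite (lin0 (gmulR a)).
Qed.

Lemma hc_mact (M : gmod A) d e (a : A) (v : M) : has_degree (ggr A) d a ->
  hc (mgr M) (d + e) (mact a v) = mact a (hc (mgr M) e v).
Proof.
move=> da; have [s us sv] := hc_sum (mgr M) v.
rewrite {1 2}sv (lin_sum (mactL a)) !(lin_sum (hcL _ _)) (lin_sum (mactL a)).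
apply: eq_bigr => f _; rewrite (@deg_eq _ _ _ _ (d + f)).
  rewrite hcK (inj_eq (addrI d)); case: eqP => // _.
  by rewrite (lin0 (mactL _)).
by apply: mact_deg => //; exact: hcKd.
Qed.

Lemma hc_mul0 d (a b : A) : has_degree (ggr A) 0 a ->
  hc (ggr A) d (a ⋆ b) = a ⋆ hc (ggr A) d b.
Proof.
move=> a0; rewrite (@hc_gmul _ _ d a b [:: 0]) // big_seq1 ?subr0.
  by rewrite (a0 : _ = _).
by rewrite (a0 : _ = _).
Qed.

Lemma hc_mact0 (M : gmod A) e (a : A) (v : M) : has_degree (ggr A) 0 a ->
  hc (mgr M) e (mact a v) = mact a (hc (mgr M) e v).
Proof. by move=> /(@hc_mact M 0 e a v); rewrite add0r. Qed.

End Basics.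

Section SubGMod.
Variables (k : fieldType) (B : lugalg k) (V : lmodType k) (U : set V).
Variables (h : int -> V -> V) (act : B -> V -> V).
Hypothesis Usub : submodule U.
Hypothesis hU : forall d v, U v -> U (h d v).
Hypothesis hL : forall d, linear (h d).
Hypothesis hK : forall d e v, h d (h e v) = if d == e then h e v else 0.
Hypothesis hsum : forall v, U v -> decomposable h v.
Hypothesis aU : forall a v, U v -> U (act a v).
Hypothesis aL : forall a, linear (act a).
Hypothesis aR : forall v, U v -> linear (act^~ v).
Hypothesis aA : forall a b v, U v -> act (a ⋆ b) v = act a (act b v).
Hypothesis adeg : forall d e a v, U v -> has_degree (ggr B) d a -> h e v = v ->
  h (d + e) (act a v) = act a v.
Hypothesis asum : forall v, U v -> decomposable (fun i => act (gone B i)) v.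

Definition smem : {pred V} := fun v => `[< U v >].

Lemma smem_submod : submod_closed smem.
Proof.
have [U0 UL] := Usub; split; first exact/asboolP.
by move=> c u v /asboolP Uu /asboolP Uv; apply/asboolP/UL.
Qed.

HB.instance Definition _ := GRing.isSubmodClosed.Build k V smem smem_submod.

Definition ssort : Type := {v : V | smem v}.
HB.instance Definition _ := SubType.copy ssort {v : V | smem v}.
HB.instance Definition _ := Choice.copy ssort {v : V | smem v}.
HB.instance Definition _ := [SubChoice_isSubLmodule of ssort by <:].

Lemma smemP (x : ssort) : U (val x).
Proof. exact/asboolP/(valP x). Qed.

Definition sin v (Uv : U v) : ssort := Sub v (asboolT Uv).

Definition shc d (x : ssort) : ssort := sin (hU d (smemP x)).
Definition sact a (x : ssort) : ssort := sin (aU a (smemP x)).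

Lemma svalL (c : k) (x y : ssort) : val (c *: x + y) = c *: val x + val y.
Proof. by []. Qed.

Lemma shcL d : linear (shc d).
Proof. by move=> c x y; apply/val_inj; rewrite svalL /= hL. Qed.

Lemma shcK d f x : shc d (shc f x) = if d == f then shc f x else 0.
Proof. by apply/val_inj; rewrite /= hK; case: eqP. Qed.

Lemma shc_sum x : exists2 s : seq int, uniq s & x = \sum_(d <- s) shc d x.
Proof.
have [s us sx] := hsum (smemP x); exists s => //.
by apply/val_inj; rewrite raddf_sum.
Qed.

Definition sgr : grading ssort := Grading shcL shcK shc_sum.

Lemma sactL a : linear (sact a).
Proof. by move=> c x y; apply/val_inj; rewrite svalL /= aL. Qed.
Lemma sactR x : linear (sact^~ x).
Proof.
by move=> c a b; apply/val_inj; rewrite svalL /= aR //; exact: smemP.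
Qed.
Lemma sactA a b x : sact (a ⋆ b) x = sact a (sact b x).
Proof. by apply/val_inj; rewrite /= aA //; exact: smemP. Qed.
Lemma sact_deg d e a x : has_degree (ggr B) d a -> has_degree sgr e x ->
  has_degree sgr (d + e) (sact a x).
Proof.
move=> da /(congr1 val) /= ex; apply/val_inj => /=.
by apply: adeg => //; exact: smemP.
Qed.
Lemma sact_sum x : exists2 s : seq (idx B), uniq s &
  x = \sum_(i <- s) sact (gone B i) x.
Proof.
have [s us sx] := asum (smemP x); exists s => //.
by apply/val_inj; rewrite raddf_sum.
Qed.

(** The graded [B]-module carried by a subspace [U] of [V].  The ambient maps
    need only behave well on [U]: [V] itself may fail to be a graded module, as
    happens for a product of modules containing their direct sum, or for a
    corner on which only a quotient of the acting algebra operates. *)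
Definition sub_gmod : gmod B := GMod sactL sactR sactA sact_deg sact_sum.

End SubGMod.

Section Homs.
Variables (k : fieldType) (A : lugalg k).
Implicit Types M N K P X : gmod A.

Definition gid M : ghom M M.
Proof. by exists id. Defined.

Definition gcomp M N X (g : ghom N X) (f : ghom M N) : ghom M X.
Proof.
exists (g \o f) => [c u v|a v|d v] /=.
- by rewrite (hfunL f) (hfunL g).
- by rewrite !hfun_act.
- by rewrite !hfun_deg.
Defined.

Definition gzero M N : ghom M N.
Proof.
exists (fun=> 0) => [c u v|a v|d v].
- by rewrite scaler0 addr0.
- by rewrite (lin0 (mactL _)).
- by rewrite (lin0 (hcL _ _)).
Defined.

Definition gadd M N (f g : ghom M N) : ghom M N.
Proof.
exists (fun x => f x + g x) => [c u v|a v|d v].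
- by rewrite (hfunL f) (hfunL g) scalerDr addrACA.
- by rewrite !hfun_act (linD (mactL _)).
- by rewrite !hfun_deg (linD (hcL _ _)).
Defined.

Definition gopp M N (f : ghom M N) : ghom M N.
Proof.
exists (fun x => - f x) => [c u v|a v|d v].
- by rewrite (hfunL f) opprD scalerN.
- by rewrite hfun_act -scaleN1r -(linZ (mactL _)) scaleN1r.
- by rewrite hfun_deg -scaleN1r -(linZ (hcL _ _)) scaleN1r.
Defined.

Definition ghom0 M N (f : ghom M N) : f 0 = 0 := lin0 (hfunL f).
Definition ghomD M N (f : ghom M N) := linD (hfunL f).
Definition ghomB M N (f : ghom M N) := linB (hfunL f).

Lemma ghom_injP M N (f : ghom M N) :
  injective f <-> forall x, f x = 0 -> x = 0.
Proof.
split=> [fI x fx|f0 x y fxy]; first by apply: fI; rewrite fx ghom0.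
by apply/subr0_eq/f0; rewrite ghomB fxy subrr.
Qed.

(** Injective and surjective homomorphisms have the universal properties of a
    kernel and of a cokernel.  With the existence of submodules and quotients
    below, no later argument depends on how these are constructed. *)
Lemma ghom_lift K M N (i : ghom K M) (f : ghom N M) : injective i ->
  (forall x, exists y, i y = f x) -> exists g : ghom N K, forall x, i (g x) = f x.
Proof.
move=> iI iS; have [g gE] := choice iS.
unshelve eexists; first (exists g).
- by move=> c u v; apply: iI; rewrite (hfunL i) !gE (hfunL f).
- by move=> a v; apply: iI; rewrite hfun_act !gE hfun_act.
- by move=> d v; apply: iI; rewrite hfun_deg !gE hfun_deg.
- exact: gE.
Qed.

Lemma ghom_factor M N X (p : ghom M N) (f : ghom M X) : surjective p ->
  (forall x, p x = 0 -> f x = 0) -> exists g : ghom N X, forall x, g (p x) = f x.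
Proof.
move=> pS pf; have [s sE] := choice pS.
have fE x y : p x = p y -> f x = f y.
  by move=> xy; apply/subr0_eq; rewrite -ghomB pf // ghomB xy subrr.
unshelve eexists; first (exists (f \o s)).
- move=> c u v /=; rewrite -(hfunL f); apply: fE.
  by rewrite (hfunL p) !sE.
- by move=> a v /=; rewrite -hfun_act; apply: fE; rewrite hfun_act !sE.
- by move=> d v /=; rewrite -hfun_deg; apply: fE; rewrite hfun_deg !sE.
- by move=> x /=; apply: fE; rewrite sE.
Qed.

Lemma exists_sub M (U : set M) : graded_submodule U ->
  exists K (i : ghom K M), injective i /\ forall x, U x <-> exists y, i y = x.
Proof.
move=> [Us Ua Uh].
pose K : gmod A := sub_gmod Us Uh (hcL (mgr M)) (hcK (mgr M))
  (fun v _ => hc_sum (mgr M) v) Ua (@mactL _ _ M) (fun v _ => mactR v)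
  (fun a b v _ => mactA a b v) (fun d e a v _ => @mact_deg _ _ M d e a v)
  (fun v _ => mact_sum v).
have i : {f : ghom K M | forall x, f x = val (x : ssort U)}.
  by unshelve eexists; first exists val.
exists K, (sval i); split=> [x y|x].
  by rewrite !(svalP i) => /val_inj.
split=> [Ux|[y <-]]; last by rewrite (svalP i); exact: smemP.
by exists (sin Ux); rewrite (svalP i).
Qed.

Lemma ker_submodule M N (f : ghom M N) : graded_submodule [set x | f x = 0].
Proof.
split=> [|a v /= fv|d v /= fv].
- split=> [|c u v /= fu fv] /=; first exact: ghom0.
  by rewrite (hfunL f) fu fv scaler0 addr0.
- by rewrite hfun_act fv (lin0 (mactL _)).
- by rewrite hfun_deg fv (lin0 (hcL _ _)).
Qed.

Lemma im_submodule M N (f : ghom M N) :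
  graded_submodule [set y | exists x, f x = y].
Proof.
split=> [|a v /= [x <-]|d v /= [x <-]].
- split=> [|c u v /= [x <-] [y <-]] /=; first by exists 0; exact: ghom0.
  by exists (c *: x + y); rewrite (hfunL f).
- by exists (mact a x); rewrite hfun_act.
- by exists (hc (mgr M) d x); rewrite hfun_deg.
Qed.

Lemma exists_ker M N (f : ghom M N) :
  exists K (i : ghom K M),
    injective i /\ forall x, f x = 0 <-> exists y, i y = x.
Proof. exact: exists_sub (ker_submodule f). Qed.

Lemma exists_im M N (f : ghom M N) :
  exists I (p : ghom M I) (i : ghom I N),
    [/\ injective i, surjective p & forall x, i (p x) = f x].
Proof.
have [I [i [iI iE]]] := exists_sub (im_submodule f).
have [|p pE] := ghom_lift iI (f := f); first by move=> x; apply/iE; exists x.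
exists I, p, i; split=> // y.
have /iE[x fx] : exists z, i z = i y by exists y.
by exists x; apply: iI; rewrite pE.
Qed.

End Homs.

Section QuotientGMod.
Variables (k : fieldType) (A : lugalg k) (M : gmod A) (U : set M).
Hypothesis HU : graded_submodule U.

Definition mqmem : {pred M} := fun v => `[< U v >].

Lemma mqmem_submod : submod_closed mqmem.
Proof.
have [[U0 UL] _ _] := HU; split; first exact/asboolP.
by move=> c u v /asboolP Uu /asboolP Uv; apply/asboolP/UL.
Qed.

HB.instance Definition _ := GRing.isSubmodClosed.Build k M mqmem mqmem_submod.

Definition mqsort : Type := Quotient.quot mqmem.
HB.instance Definition _ := GRing.Zmodule.on mqsort.

Definition mqpi (a : M) : mqsort := \pi_(Quotient.quot mqmem)%qT a.
Definition mqrepr (x : mqsort) : M := repr x.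

Lemma mqreprK x : mqpi (mqrepr x) = x.
Proof. exact: reprK. Qed.

Lemma mqpiD a b : mqpi (a + b) = mqpi a + mqpi b.
Proof. exact: raddfD. Qed.

Lemma mqpiP a b : mqpi a = mqpi b <-> U (a - b).
Proof.
rewrite /mqpi; split=> [/eqP|Jab]; last apply/eqP.
  by rewrite -Quotient.idealrBE => /asboolP.
by rewrite -Quotient.idealrBE; apply/asboolP.
Qed.

Lemma mqreprB a : U (mqrepr (mqpi a) - a).
Proof. by apply/mqpiP; rewrite mqreprK. Qed.

Definition mqscale (c : k) (x : mqsort) : mqsort := mqpi (c *: mqrepr x).

Lemma mqpiZ c a : mqpi (c *: a) = mqscale c (mqpi a).
Proof.
apply/esym/mqpiP; rewrite -scalerBr; have [Us _ _] := HU.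
by apply: submoduleZ => //; exact: mqreprB.
Qed.

Lemma mqscaleA c d x : mqscale c (mqscale d x) = mqscale (c * d) x.
Proof. by rewrite -(mqreprK x) -!mqpiZ scalerA. Qed.
Lemma mqscale1 : left_id 1 mqscale.
Proof. by move=> x; rewrite -(mqreprK x) -mqpiZ scale1r. Qed.
Lemma mqscaleDr : right_distributive mqscale +%R.
Proof.
move=> c x y; rewrite -(mqreprK x) -(mqreprK y) -mqpiD -!mqpiZ.
by rewrite scalerDr mqpiD.
Qed.
Lemma mqscaleDl x : {morph mqscale^~ x : c d / c + d}.
Proof. by move=> c d; rewrite -(mqreprK x) -!mqpiZ scalerDl mqpiD. Qed.

HB.instance Definition _ :=
  GRing.Zmodule_isLmodule.Build k mqsort mqscaleA mqscale1 mqscaleDr mqscaleDl.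

Lemma mqpiL : linear mqpi.
Proof. by move=> c u v; rewrite mqpiD mqpiZ. Qed.

Definition mqhc (d : int) (x : mqsort) : mqsort := mqpi (hc (mgr M) d (mqrepr x)).
Definition mqact (a : A) (x : mqsort) : mqsort := mqpi (mact a (mqrepr x)).

Lemma mqhcE d a : mqhc d (mqpi a) = mqpi (hc (mgr M) d a).
Proof.
have [_ _ Uh] := HU.
by apply/mqpiP; rewrite -(linB (hcL _ _)); exact/Uh/mqreprB.
Qed.

Lemma mqactE a v : mqact a (mqpi v) = mqpi (mact a v).
Proof.
have [_ Ua _] := HU.
by apply/mqpiP; rewrite -(linB (mactL _)); exact/Ua/mqreprB.
Qed.

Lemma mqhcL d : linear (mqhc d).
Proof.
move=> c x y; rewrite -(mqreprK x) -(mqreprK y) -mqpiL !mqhcE.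
by rewrite hcL mqpiL.
Qed.

Lemma mqhcK d e x : mqhc d (mqhc e x) = if d == e then mqhc e x else 0.
Proof.
rewrite -(mqreprK x) !mqhcE hcK; case: eqP => // _.
exact: (lin0 mqpiL).
Qed.

Lemma mqhc_sum x : exists2 s : seq int, uniq s & x = \sum_(d <- s) mqhc d x.
Proof.
have [s us sx] := hc_sum (mgr M) (mqrepr x); exists s => //.
by rewrite -{1}(mqreprK x) sx (lin_sum mqpiL).
Qed.

Definition mqgr : grading mqsort := Grading mqhcL mqhcK mqhc_sum.

Lemma mqactL a : linear (mqact a).
Proof.
move=> c x y; rewrite -(mqreprK x) -(mqreprK y) -mqpiL !mqactE.
by rewrite mactL mqpiL.
Qed.

Lemma mqactR x : linear (mqact^~ x).
Proof.
by move=> c a b; rewrite -(mqreprK x) !mqactE mactR mqpiL.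
Qed.

Lemma mqactA a b x : mqact (a ⋆ b) x = mqact a (mqact b x).
Proof. by rewrite -(mqreprK x) !mqactE mactA. Qed.

Lemma mqact_deg d e a x : has_degree (ggr A) d a -> has_degree mqgr e x ->
  has_degree mqgr (d + e) (mqact a x).
Proof.
move=> da <-; rewrite /has_degree /= mqactE mqhcE; congr mqpi.
by apply: mact_deg => //; exact: hcKd.
Qed.

Lemma mqact_sum x : exists2 s : seq (idx A), uniq s &
  x = \sum_(i <- s) mqact (gone A i) x.
Proof.
have [s us sx] := mact_sum (mqrepr x); exists s => //.
by rewrite -{1}(mqreprK x) sx (lin_sum mqpiL).
Qed.

Definition quot_gmod : gmod A := GMod mqactL mqactR mqactA mqact_deg mqact_sum.

Lemma exists_quot :
  exists Q (p : ghom M Q), surjective p /\ forall x, p x = 0 <-> U x.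
Proof.
have p : {f : ghom M quot_gmod | forall x, f x = mqpi x}.
  unshelve eexists; first (exists mqpi).
  - exact: mqpiL.
  - by move=> a v /=; rewrite mqactE.
  - by move=> d v /=; rewrite mqhcE.
  - by [].
exists quot_gmod, (sval p); split=> [y|x].
  by exists (mqrepr y); rewrite (svalP p) mqreprK.
rewrite (svalP p) -(lin0 mqpiL); split=> [/mqpiP|Ux]; first by rewrite subr0.
by apply/mqpiP; rewrite subr0.
Qed.

End QuotientGMod.

Section ProductGMod.
Variables (k : fieldType) (A : lugalg k) (M N : gmod A).

Definition phc d (v : M * N) : M * N := (hc (mgr M) d v.1, hc (mgr N) d v.2).
Definition pact (a : A) (v : M * N) : M * N := (mact a v.1, mact a v.2).

Lemma phcL d : linear (phc d).
Proof. by move=> c u v; rewrite /phc /= !hcL. Qed.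
Lemma phcK d e v : phc d (phc e v) = if d == e then phc e v else 0.
Proof. by rewrite /phc /= !hcK; case: eqP. Qed.
Lemma pactL a : linear (pact a).
Proof. by move=> c u v; rewrite /pact /= !mactL. Qed.
Lemma pactR v : linear (pact^~ v).
Proof. by move=> c a b; rewrite /pact /= !mactR. Qed.
Lemma pactA a b v : pact (a ⋆ b) v = pact a (pact b v).
Proof. by rewrite /pact /= !mactA. Qed.

Lemma pair_sum I (s : seq I) (P : pred I) (F : I -> M) (G : I -> N) :
  \sum_(i <- s | P i) (F i, G i) =
  (\sum_(i <- s | P i) F i, \sum_(i <- s | P i) G i) :> M * N.
Proof.
by elim/big_rec3: _ => // i x y z _ ->.
Qed.

Lemma pair_decomposable (I : choiceType) (p : I -> M * N -> M * N) (f : I -> M -> M)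
    (g : I -> N -> N) :
    (forall i, linear (p i)) ->
    (forall i j v, p i (p j v) = if i == j then p j v else 0) ->
    (forall i v, p i v = (f i v.1, g i v.2)) ->
    (forall i, linear (f i)) -> (forall i, linear (g i)) ->
  (forall v, decomposable f v) -> (forall v, decomposable g v) ->
  forall v, decomposable p v.
Proof.
move=> pL pK pE fL gL fS gS [u v].
have -> : (u, v) = 1 *: (u, 0) + (0, v) :> M * N.
  by rewrite scale1r; apply: injective_projections; rewrite /= ?addr0 ?add0r.
apply: decomposableL => //.
  have [s us su] := fS u; exists s => //.
  under eq_bigr do rewrite pE /= (lin0 (gL _)).
  by rewrite pair_sum -su big1.
have [s us sv] := gS v; exists s => //.
under eq_bigr do rewrite pE /= (lin0 (fL _)).
by rewrite pair_sum -sv big1.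
Qed.

Definition pgr : grading (M * N)%type.
Proof.
apply: (Grading phcL phcK).
apply: (@pair_decomposable _ phc (hc (mgr M)) (hc (mgr N))) => //.
- exact: phcL.
- exact: phcK.
- exact: hcL.
- exact: hcL.
- exact: hc_sum.
- exact: hc_sum.
Defined.

Lemma pact_deg d e a v : has_degree (ggr A) d a -> has_degree pgr e v ->
  has_degree pgr (d + e) (pact a v).
Proof.
move=> da ev; rewrite /has_degree /= /phc /pact /=.
have e1 := congr1 fst ev; have e2 := congr1 snd ev.
by congr (_, _); apply: mact_deg.
Qed.

Lemma pact_sum v : exists2 s : seq (idx A), uniq s &
  v = \sum_(i <- s) pact (gone A i) v.
Proof.
apply: (@pair_decomposable _ (fun i => pact (gone A i))
  (fun i => mact (gone A i)) (fun i => mact (gone A i))) => //.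
- by move=> i; exact: pactL.
- by move=> i j w; rewrite /pact /= !mact_gone; case: eqP.
- by move=> i; exact: mactL.
- by move=> i; exact: mactL.
- exact: mact_sum.
- exact: mact_sum.
Qed.

Definition prod_gmod : gmod A := GMod pactL pactR pactA pact_deg pact_sum.

Definition gfst : ghom prod_gmod M.
Proof. by exists fst. Defined.
Definition gsnd : ghom prod_gmod N.
Proof. by exists snd. Defined.

Definition ginl : ghom M prod_gmod.
Proof.
exists (fun x => (x, 0)) => [c u v|a v|d v] /=.
- by apply: injective_projections; rewrite /= ?scaler0 ?addr0.
- by rewrite /pact /= (lin0 (mactL _)).
- by rewrite /phc /= (lin0 (hcL _ _)).
Defined.
Definition ginr : ghom N prod_gmod.
Proof.
exists (fun x => (0, x)) => [c u v|a v|d v] /=.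
- by apply: injective_projections; rewrite /= ?scaler0 ?addr0.
- by rewrite /pact /= (lin0 (mactL _)).
- by rewrite /phc /= (lin0 (hcL _ _)).
Defined.

Lemma prod_eq0 (x : prod_gmod) : gfst x = 0 -> gsnd x = 0 -> x = 0.
Proof. by case: x => [x y] /= -> ->. Qed.

Lemma prodE (x : prod_gmod) : x = ginl (gfst x) + ginr (gsnd x).
Proof.
by case: x => x y; apply: injective_projections; rewrite /= ?addr0 ?add0r.
Qed.

End ProductGMod.

(** * Free graded modules *)

Section FreeModules.
Variables (k : fieldType) (A : lugalg k).

Lemma gone_decomposable (a : A) :
  decomposable (fun i => gmul (gone A i)) a.
Proof.
have [s us sa] := gone_sum a; exists s => //.
rewrite {1}sa big_seq [RHS]big_seq; apply: eq_bigr => i si.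
rewrite [in RHS]sa (lin_sum (gmulL _)) [RHS](bigD1_seq i) //=
    [X in _ = _ + X]big1 => [|j ji].
  rewrite addr0 (lin_sum (gmulL _)); apply: eq_bigr => j _.
  by rewrite -!gmulA gone_mull eqxx.
rewrite (lin_sum (gmulL _)) big1 // => l _.
by rewrite -!gmulA gone_mull eq_sym (negPf ji).
Qed.

Variables (Z : choiceType) (e : Z -> A) (d : Z -> int).
Hypothesis ee : forall z, e z ⋆ e z = e z.
Hypothesis e0 : forall z, has_degree (ggr A) 0 (e z).

Definition single z (a : A) : Z -> A := fun z' => if z' == z then a else 0.

Definition free_set : set (Z -> A) :=
  [set f | (exists s : seq Z, forall z, z \notin s -> f z = 0) /\
           forall z, f z ⋆ e z = f z].

Definition free_hc (n : int) (f : Z -> A) : Z -> A :=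
  fun z => hc (ggr A) (n - d z) (f z).
Definition free_act (a : A) (f : Z -> A) : Z -> A := fun z => a ⋆ f z.

Lemma free_hcL n : linear (free_hc n).
Proof. by move=> c f g; apply/funext => z; rewrite /free_hc /= hcL. Qed.
Lemma free_hcK n m f :
  free_hc n (free_hc m f) = if n == m then free_hc m f else 0.
Proof.
apply/funext => z; rewrite /free_hc hcK.
by rewrite (inj_eq (addIr (- d z))); case: eqP.
Qed.
Lemma free_actL a : linear (free_act a).
Proof. by move=> c f g; apply/funext => z; rewrite /free_act /= gmulL. Qed.

Lemma hc_mule n z (a : A) : hc (ggr A) n (a ⋆ e z) = hc (ggr A) n a ⋆ e z.
Proof.
have [s us sa] := hc_sum (ggr A) a.
rewrite (hc_gmul _ _ us sa) [in RHS]sa.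
rewrite !(lin_sum (hcL _ _)) (lin_sum (gmulR _)); apply: eq_bigr => f _.
rewrite (deg_eq _ (e0 z)) subr_eq0 hcK.
by case: eqP => // _; rewrite ?(lin0 (gmulL _)) ?(lin0 (gmulR _)).
Qed.

Lemma single_mem z a : a ⋆ e z = a -> free_set (single z a).
Proof.
move=> az; split.
  by exists [:: z] => z'; rewrite inE /single => /negPf->.
by move=> z'; rewrite /single; case: eqP => [->//|_]; rewrite (lin0 (gmulR _)).
Qed.

Lemma fct_linE (c : k) (f g : Z -> A) z : (c *: f + g) z = c *: f z + g z.
Proof. by []. Qed.

Lemma free_sub : submodule free_set.
Proof.
split; first by split=> [|z]; [exists [::] | rewrite (lin0 (gmulR _))].
move=> c u v [[s su] ue] [[t tv] ve]; split=> [|z].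
  exists (s ++ t) => z; rewrite mem_cat negb_or => /andP[zs zt].
  by rewrite fct_linE su // tv // scaler0 addr0.
by rewrite /= gmulR ue ve.
Qed.

Lemma single_sum (s : seq Z) (f : Z -> A) : uniq s ->
  (forall z, z \notin s -> f z = 0) -> f = \sum_(z <- s) single z (f z).
Proof.
move=> us sf; apply/funext => z; rewrite fct_sumE.
case: (boolP (z \in s)) => zs.
  rewrite (bigD1_seq z) //= {1}/single eqxx big1 ?addr0 // => z' zz'.
  by rewrite /single eq_sym (negPf zz').
rewrite sf // big_seq big1 // => z' z's; rewrite /single.
by case: eqP => // zz'; move: zs; rewrite zz' z's.
Qed.

Lemma free_ind (U : set (Z -> A)) : submodule U ->
  (forall z a, a ⋆ e z = a -> U (single z a)) -> free_set `<=` U.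
Proof.
move=> Us US f [[s sf] fe].
have -> : f = \sum_(z <- undup s) single z (f z).
  by apply: single_sum (undup_uniq s) _ => z; rewrite mem_undup; exact: sf.
by apply: submodule_sum => // z _; exact: US.
Qed.

Lemma decomposable_submodule (I : choiceType) (V : lmodType k)
    (p : I -> V -> V) :
    (forall i, linear (p i)) ->
    (forall i j v, p i (p j v) = if i == j then p j v else 0) ->
  submodule [set v | decomposable p v].
Proof.
move=> pL pK; split; first exact: decomposable0.
by move=> c u v; exact: decomposableL.
Qed.

Lemma singleE (I : Type) (r : seq I) z (F : I -> A) :
  single z (\sum_(i <- r) F i) = \sum_(i <- r) single z (F i).
Proof.
apply/funext => z'; rewrite fct_sumE /single.
by case: eqP => // _; rewrite big1.
Qed.

(** The direct sum of the modules [A e_z], with the summand of [z] shifted by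
    [d z].  Realising it inside the space of all functions keeps the coefficients
    of an element available; on that whole space the degree components need not
    sum up. *)
Definition free_gmod : gmod A.
Proof.
apply: (@sub_gmod _ A _ free_set free_hc free_act free_sub).
- move=> n f [[s sf] fe]; split=> [|z].
    by exists s => z /sf fz; rewrite /free_hc fz (lin0 (hcL _ _)).
  by rewrite /free_hc -hc_mule fe.
- exact: free_hcL.
- exact: free_hcK.
- apply: free_ind.
    by apply: decomposable_submodule; [exact: free_hcL | exact: free_hcK].
  move=> z a _; have [s us sa] := hc_sum (ggr A) a.
  exists (map (fun n => n + d z) s); first by rewrite map_inj_uniq //; exact: addIr.
  rewrite big_map {1}sa singleE; apply: eq_bigr => n _.
  apply/funext => z'; rewrite /single /free_hc.
  by case: eqP => [->|_]; rewrite ?addrK // (lin0 (hcL _ _)).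
- move=> a f [[s sf] fe]; split=> [|z].
    by exists s => z /sf fz; rewrite /free_act fz (lin0 (gmulL _)).
  by rewrite /free_act -gmulA fe.
- exact: free_actL.
- by move=> f _ c a b; apply/funext => z; rewrite /free_act /= gmulR.
- by move=> a b f _; apply/funext => z; rewrite /free_act gmulA.
- move=> n m a f _ na mf; apply/funext => z; rewrite /free_hc /free_act.
  rewrite -addrA; apply: gmul_deg => //.
  by rewrite /has_degree /=; have /(congr1 (@^~ z)) := mf.
- apply: free_ind.
    apply: decomposable_submodule => [i|i j f]; first exact: free_actL.
    apply/funext => z; rewrite /free_act gone_mull.
    by case: eqP.
  move=> z a _; have [s us sa] := gone_decomposable a; exists s => //.
  rewrite {1}sa singleE; apply: eq_bigr => i _.
  apply/funext => z'; rewrite /single /free_act.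
  by case: eqP => // _; rewrite (lin0 (gmulL _)).
Defined.

Definition fcoef (x : free_gmod) : Z -> A := val (x : ssort free_set).

Lemma fcoef_inj : injective fcoef.
Proof. by move=> x y /val_inj. Qed.

Lemma fcoefP x : free_set (fcoef x).
Proof. exact: (smemP (x : ssort free_set)). Qed.

Lemma fcoefL c x y z : fcoef (c *: x + y) z = c *: fcoef x z + fcoef y z.
Proof. by []. Qed.
Lemma fcoef_act a x z : fcoef (mact a x) z = a ⋆ fcoef x z.
Proof. by []. Qed.
Lemma fcoef_hc n x z :
  fcoef (hc (mgr free_gmod) n x) z = hc (ggr A) (n - d z) (fcoef x z).
Proof. by []. Qed.
Lemma fcoef_e x z : fcoef x z ⋆ e z = fcoef x z.
Proof. by have [_] := fcoefP x. Qed.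

Lemma fsupp_ex x : exists s : seq Z, uniq s /\ forall z, z \notin s -> fcoef x z = 0.
Proof.
have [[s sx] _] := fcoefP x; exists (undup s); split; first exact: undup_uniq.
by move=> z; rewrite mem_undup; exact: sx.
Qed.

Lemma fcoef_sum I (r : seq I) (P : pred I) (F : I -> free_gmod) z :
  fcoef (\sum_(i <- r | P i) F i) z = \sum_(i <- r | P i) fcoef (F i) z.
Proof.
by apply: (big_morph (fun x => fcoef x z)).
Qed.

Definition fsingle z a (az : a ⋆ e z = a) : free_gmod := sin (single_mem az).
Definition fgen z : free_gmod := fsingle (ee z).

Lemma fcoef_single z a (az : a ⋆ e z = a) z' :
  fcoef (fsingle az) z' = if z' == z then a else 0.
Proof. by []. Qed.

Lemma mact_fgen a z (az : a ⋆ e z = a) : mact a (fgen z) = fsingle az.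
Proof.
apply: fcoef_inj; apply/funext => z'; rewrite fcoef_act /fgen !fcoef_single.
by case: eqP => // _; rewrite (lin0 (gmulL _)).
Qed.

Lemma fgen_e z : mact (e z) (fgen z) = fgen z.
Proof. by rewrite (mact_fgen (ee z)). Qed.

Lemma fgen_deg z : has_degree (mgr free_gmod) (d z) (fgen z).
Proof.
apply: fcoef_inj; apply/funext => z'; rewrite fcoef_hc /fgen !fcoef_single.
case: eqP => [->|_]; last by rewrite (lin0 (hcL _ _)).
by rewrite subrr; exact: e0.
Qed.

Lemma fgen_sum x (s : seq Z) : uniq s -> (forall z, z \notin s -> fcoef x z = 0) ->
  x = \sum_(z <- s) mact (fcoef x z) (fgen z).
Proof.
move=> us sx; apply: fcoef_inj; rewrite {1}(single_sum us sx).
apply/funext => z; rewrite fct_sumE fcoef_sum; apply: eq_bigr => z' _.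
by rewrite (mact_fgen (fcoef_e x z')).
Qed.

Lemma free_hom (M : gmod A) (w : Z -> M) :
    (forall z, mact (e z) (w z) = w z) ->
    (forall z, has_degree (mgr M) (d z) (w z)) ->
  exists h : ghom free_gmod M, forall x s, uniq s ->
    (forall z, z \notin s -> fcoef x z = 0) ->
    h x = \sum_(z <- s) mact (fcoef x z) (w z).
Proof.
move=> ew dw; have [supp suppE] := choice fsupp_ex.
pose ev x := \sum_(z <- supp x) mact (fcoef x z) (w z).
have evE x s : uniq s -> (forall z, z \notin s -> fcoef x z = 0) ->
    ev x = \sum_(z <- s) mact (fcoef x z) (w z).
  move=> us sx; have [ut tx] := suppE x; rewrite /ev.
  set t := supp x in ut tx *.
  rewrite (bigID (fun z => z \in s)) /= [X in _ + X]big1 ?addr0; last first.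
    by move=> z zs; rewrite sx // (lin0 (mactR _)).
  rewrite [RHS](bigID (fun z => z \in t)) /= [X in _ = _ + X]big1 ?addr0; last first.
    by move=> z zs; rewrite tx // (lin0 (mactR _)).
  rewrite -[LHS]big_filter -[RHS]big_filter; apply: perm_big; apply: uniq_perm.
  - exact: filter_uniq.
  - exact: filter_uniq.
  - by move=> z; rewrite !mem_filter andbC.
have common (xs : seq free_gmod) : exists2 s : seq Z, uniq s &
    forall x, x \in xs -> forall z, z \notin s -> fcoef x z = 0.
  elim: xs => [|x xs [s us sxs]]; first by exists [::].
  exists (undup (supp x ++ s)); first exact: undup_uniq.
  move=> y; rewrite inE => /predU1P[->|/sxs sy] z;
    rewrite mem_undup mem_cat negb_or => /andP[zx zs]; last exact: sy.
  by have [_ ->] := suppE x.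
unshelve eexists; first (exists ev); last exact: evE.
- move=> c x y; have [s us sE] := common [:: c *: x + y; x; y].
  rewrite !(evE _ s) //; try by apply: sE; rewrite !inE eqxx ?orbT.
  rewrite scaler_sumr -big_split; apply: eq_bigr => z _ /=.
  by rewrite fcoefL mactR.
- move=> a x; have [s us sE] := common [:: mact a x; x].
  rewrite !(evE _ s) //; try by apply: sE; rewrite !inE eqxx ?orbT.
  rewrite (lin_sum (mactL _)); apply: eq_bigr => z _.
  by rewrite fcoef_act mactA.
- move=> n x; have [s us sE] := common [:: hc (mgr free_gmod) n x; x].
  rewrite !(evE _ s) //; try by apply: sE; rewrite !inE eqxx ?orbT.
  rewrite (lin_sum (hcL _ _)); apply: eq_bigr => z _.
  rewrite fcoef_hc; set a := fcoef x z.
  have [t ut ta] := hc_sum (ggr A) a.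
  rewrite {1 2}ta !(lin_sum (hcL _ _)) !(lin_sum (mactR _)) (lin_sum (hcL _ _)).
  apply: eq_bigr => m _; rewrite hcK.
  rewrite (@deg_eq _ _ (mgr M) n (m + d z)); last first.
    by apply: mact_deg => //; exact: hcKd.
  rewrite subr_eq; case: eqP => // _.
  by rewrite (lin0 (mactR _)).
Qed.

Lemma fgen_supp z z' : z' \notin [:: z] -> fcoef (fgen z) z' = 0.
Proof. by rewrite inE => /negPf zz'; rewrite fcoef_single zz'. Qed.

Lemma free_homg (M : gmod A) (w : Z -> M) :
    (forall z, mact (e z) (w z) = w z) ->
    (forall z, has_degree (mgr M) (d z) (w z)) ->
  exists h : ghom free_gmod M, forall z, h (fgen z) = w z.
Proof.
move=> ew dw; have [h hE] := free_hom ew dw; exists h => z.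
rewrite (hE _ [:: z]) //; last exact: fgen_supp.
by rewrite big_seq1 /fgen fcoef_single eqxx.
Qed.

Lemma free_ext (M : gmod A) (g h : ghom free_gmod M) :
  (forall z, g (fgen z) = h (fgen z)) -> forall x, g x = h x.
Proof.
move=> gh x; have [s [us sx]] := fsupp_ex x; rewrite (fgen_sum us sx).
rewrite (lin_sum (hfunL g)) (lin_sum (hfunL h)); apply: eq_bigr => z _.
by rewrite !hfun_act gh.
Qed.

Lemma free_projective : projective free_gmod.
Proof.
move=> M N g f gS.
have [w wE] := choice (fun z => gS (f (fgen z))).
have [z|z|h hE] := @free_homg M (fun z => mact (e z) (hc (mgr M) (d z) (w z))).
- by rewrite -mactA ee.
- by rewrite -[X in has_degree _ X]add0r; apply: mact_deg => //; exact: hcKd.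
exists h; apply: (@free_ext _ (gcomp g h) f) => z /=.
rewrite hE hfun_act hfun_deg wE -hfun_deg.
by rewrite (fgen_deg z : _ = _) -hfun_act fgen_e.
Qed.

End FreeModules.


Arguments fgen {k A Z e d} ee e0 z.

Section FreeOnIdempotents.
Variables (k : fieldType) (A : lugalg k).

(** The direct sum of the projectives [A 1_(i z)], shifted in degree by [d z]. *)
Definition gfree (Z : choiceType) (i : Z -> idx A) (d : Z -> int) : gmod A :=
  free_gmod d (fun z => gone_deg0 (i z)).

Definition ggen (Z : choiceType) (i : Z -> idx A) (d : Z -> int) (z : Z) :
  gfree i d := fgen (fun z => gone_idem (i z)) (fun z => gone_deg0 (i z)) z.

Lemma gfree_projective (Z : choiceType) (i : Z -> idx A) (d : Z -> int) :
  projective (gfree i d).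
Proof. by apply: free_projective => z; exact: gone_idem. Qed.

Variables (I : choiceType) (s : I -> idx A) (M : gmod A).

(** Homogeneous generators of the submodule generated by all the [1_(s i) M],
    indexed by the vectors of which they are components.  They define a free
    module mapping onto that submodule. *)
Definition comp_vec (z : I * int * M) : M :=
  mact (gone A (s z.1.1)) (hc (mgr M) z.1.2 z.2).

Lemma comp_vec_idem z : mact (gone A (s z.1.1)) (comp_vec z) = comp_vec z.
Proof. by rewrite /comp_vec mact_gone eqxx. Qed.

Lemma comp_vec_deg z : has_degree (mgr M) z.1.2 (comp_vec z).
Proof.
rewrite -[z.1.2]add0r.
by apply: mact_deg; [exact: gone_deg0 | exact: hcKd].
Qed.

Lemma comp_vec_submodule (U : set M) : submodule U ->
  (forall z, U (comp_vec z)) -> forall i v, U (mact (gone A (s i)) v).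
Proof.
move=> Us Uc i v; have [t _ {1}->] := hc_sum (mgr M) v.
rewrite (lin_sum (mactL _)); apply: (submodule_sum Us) => n _.
exact: (Uc (i, n, v)).
Qed.

Definition comp_idx (z : I * int * M) := s z.1.1.
Definition comp_deg (z : I * int * M) := z.1.2.

Lemma comp_cover : exists h : ghom (gfree comp_idx comp_deg) M,
  forall z, h (ggen comp_idx comp_deg z) = comp_vec z.
Proof. by apply: free_homg; [exact: comp_vec_idem | exact: comp_vec_deg]. Qed.

End FreeOnIdempotents.

Lemma free_cover (k : fieldType) (A : lugalg k) (M : gmod A) :
  exists P (p : ghom P M), projective P /\ surjective p.
Proof.
have [h hE] := @comp_cover _ A _ id M.
exists (gfree (@comp_idx _ A _ id M) (@comp_deg _ A _ M)), h.
split; first exact: gfree_projective.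
have [imS _ _] := im_submodule h.
move=> v; pose im := [set y | exists x, h x = y]; change (im v).
have [s _ ->] := mact_sum v; apply: (submodule_sum imS) => i _.
apply: (comp_vec_submodule (s := id) imS) => z.
by exists (ggen (@comp_idx _ A _ id M) (@comp_deg _ A _ M) z); rewrite hE.
Qed.

(** * Projective dimension *)

Section ProjectiveDimension.
Variables (k : fieldType) (A : lugalg k).
Implicit Types M N K P R X : gmod A.

Definition ses K M N (i : ghom K M) (p : ghom M N) : Prop :=
  [/\ injective i, surjective p & forall x, p x = 0 <-> exists y, i y = x].

Lemma ses_comp0 K M N (i : ghom K M) (p : ghom M N) y : ses i p -> p (i y) = 0.
Proof. by move=> [_ _ pE]; apply/pE; exists y. Qed.

Lemma ses_ker M N (p : ghom M N) : surjective p ->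
  exists K (i : ghom K M), ses i p.
Proof. by move=> pS; have [K [i [iI iE]]] := exists_ker p; exists K, i. Qed.

Definition retract K X : Prop :=
  exists (i : ghom K X) (r : ghom X K), forall x, r (i x) = x.

Lemma projective_retract K X : retract K X -> projective X -> projective K.
Proof.
move=> [i [r ri]] pX M N g f gS.
have [h hE] := pX _ _ g (gcomp f r) gS.
by exists (gcomp h i) => x /=; rewrite hE /= ri.
Qed.

Lemma projective_prod P R : projective P -> projective R ->
  projective (prod_gmod P R).
Proof.
move=> pP pR M N g f gS.
have [h hE] := pP _ _ g (gcomp f (ginl P R)) gS.
have [l lE] := pR _ _ g (gcomp f (ginr P R)) gS.
exists (gadd (gcomp h (gfst P R)) (gcomp l (gsnd P R))) => x /=.
by rewrite ghomD hE lE /= -ghomD -prodE.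
Qed.

Lemma projective_split M N (p : ghom M N) : projective N -> surjective p ->
  exists s : ghom N M, forall x, p (s x) = x.
Proof. by move=> pN pS; have [h hE] := pN _ _ p (gid N) pS; exists h. Qed.

Lemma ses_retract K M N (i : ghom K M) (p : ghom M N) : ses i p ->
  projective N -> retract K M.
Proof.
move=> [iI pS ip] pN; have [s sE] := projective_split pN pS.
pose q : ghom M M := gadd (gid M) (gopp (gcomp s p)).
have [x|r rE] := ghom_lift (i := i) (f := q) iI.
  by apply/ip; rewrite /= ghomB sE subrr.
exists i, r => x; apply: iI; rewrite rE /=.
by have /(_ (i x)) := ip; case=> _ -> //; [rewrite ghom0 subr0 | exists x].
Qed.

(** Projective dimension at most [n], quantifying over all the first steps of a
    projective resolution.  The quantifier makes the property inherited by
    retracts, and Schanuel's lemma [pd_cover] shows that one first step is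
    enough. *)
Fixpoint pd (n : nat) M : Prop :=
  if n is m.+1 then
    forall K P (i : ghom K P) (p : ghom P M), projective P -> ses i p -> pd m K
  else projective M.

Lemma pd_retract n K X : retract K X -> pd n X -> pd n K.
Proof.
elim: n K X => [|n IHn] K X /=; first exact: projective_retract.
move=> [i [r ri]] pX K1 P j p pP [jI pS jp].
have [C [c [cI rc]]] := exists_ker r.
have [R [q [pR qS]]] := free_cover C.
(* The cover of X is the sum of P, covering K, and of a cover of ker r. *)
pose t : ghom (prod_gmod P R) X :=
  gadd (gcomp (gcomp i p) (gfst P R)) (gcomp (gcomp c q) (gsnd P R)).
have rcq y : r (c (q y)) = 0 by apply/rc; exists (q y).
have rt x : r (t x) = p (gfst P R x) by rewrite /= ghomD ri rcq addr0.
have tS : surjective t.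
  move=> x; have [y py] := pS (r x).
  have /rc[z cz] : r (x - i (r x)) = 0 by rewrite ghomB ri subrr.
  have [w qw] := qS z; exists (y, w) => /=.
  by rewrite py qw cz addrC subrK.
have [L [l lt]] := ses_ker tS.
have pdL := pX _ _ _ _ (projective_prod pP pR) lt.
have [lI _ lE] := lt.
apply: IHn pdL.
have [x|a aE] := ghom_lift (i := l) (f := gcomp (ginl P R) j) lI.
  have pj : p (j x) = 0 by apply/jp; exists x.
  by apply/lE; rewrite /= pj !ghom0 addr0.
have [x|b bE] := ghom_lift (i := j) (f := gcomp (gfst P R) l) jI.
  apply/jp; rewrite /= -rt.
  have -> : t (l x) = 0 by apply/lE; exists x.
  exact: ghom0.
by exists a, b => x; apply: jI; rewrite bE /= aE.
Qed.

(** Third isomorphism theorem for the kernels of [P -> M] and of [P -> N]. *)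
Lemma ses_cover K M N X1 P (i : ghom K M) (p : ghom M N)
    (j : ghom X1 P) (q : ghom P M) : ses i p -> ses j q ->
  exists N1 (r : ghom N1 P) (a : ghom X1 N1) (b : ghom N1 K),
    ses r (gcomp p q) /\ ses a b.
Proof.
move=> ip jq; have [jI qS jE] := jq; have [iI pS iE] := ip.
have pqS : surjective (gcomp p q).
  by move=> y; have [x <-] := pS y; have [z <-] := qS x; exists z.
have [N1 [r rs]] := ses_ker pqS; have [rI _ rE] := rs.
have [x|a aE] := ghom_lift (i := r) (f := j) rI.
  apply/rE => /=; have -> : q (j x) = 0 by apply/jE; exists x.
  exact: ghom0.
have [x|b bE] := ghom_lift (i := i) (f := gcomp q r) iI.
  by apply/iE; exact: (ses_comp0 x rs).
exists N1, r, a, b; split=> //.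
split.
- by move=> x y axy; apply: jI; rewrite -!aE axy.
- move=> y; have [z qz] := qS (i y).
  have /rE[x rx] : gcomp p q z = 0 by rewrite /= qz; exact: ses_comp0 ip.
  by exists x; apply: iI; rewrite bE /= rx.
- move=> x; split=> [bx|[y <-]].
    have /jE[y jy] : q (r x) = 0 by rewrite -[q _]bE bx ghom0.
    by exists y; apply: rI; rewrite aE.
  by apply: iI; rewrite bE /= aE ghom0; apply/jE; exists y.
Qed.

Lemma pd_ext0 n K X R (i : ghom K X) (p : ghom X R) : ses i p ->
  projective R -> pd n K -> pd n X.
Proof.
move=> ip pR; have [iI pS iE] := ip; case: n => [|n] /= pdK.
  have [s sE] := projective_split pR pS.
  move=> M N g f gS.
  have [h hE] := pdK _ _ g (gcomp f i) gS.
  have [l lE] := pR _ _ g (gcomp f s) gS.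
  have [x|r rE] := ghom_lift (i := i) (f := gadd (gid X) (gopp (gcomp s p))) iI.
    by apply/iE; rewrite /= ghomB sE subrr.
  exists (gadd (gcomp h r) (gcomp l p)) => x /=.
  by rewrite ghomD hE lE /= rE /= -ghomD subrK.
move=> X1 P j q pP jq; have [jI qS jE] := jq.
have [R1 [r [a [b [rs ab]]]]] := ses_cover ip jq.
have pR1 : projective R1 by apply: projective_retract pP; exact: ses_retract rs _.
exact: (pdK _ _ a b pR1).
Qed.

Lemma pullback M N R (p : ghom M N) (q : ghom R N) :
  exists X (f : ghom X M) (g : ghom X R),
    [/\ forall x, p (f x) = q (g x),
        forall x, f x = 0 -> g x = 0 -> x = 0 &
        forall y z, p y = q z -> exists2 x, f x = y & g x = z].
Proof.
pose t : ghom (prod_gmod M R) N :=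
  gadd (gcomp p (gfst M R)) (gopp (gcomp q (gsnd M R))).
have [X [i [iI iE]]] := exists_ker t.
exists X, (gcomp (gfst M R) i), (gcomp (gsnd M R) i); split.
- move=> x; apply/subr0_eq; change (t (i x) = 0); apply/iE.
  by exists x.
- by move=> x fx gx; apply/((ghom_injP i).1 iI)/prod_eq0.
- move=> y z yz; have /iE[x ix] : t (y, z) = 0 by rewrite /= yz subrr.
  by exists x; rewrite /= ix.
Qed.

(** The elements of the pullback with second component [0] are those of [ker p]. *)
Lemma pullback_ses K M N R X (i : ghom K M) (p : ghom M N) (q : ghom R N)
    (f : ghom X M) (g : ghom X R) : ses i p ->
    (forall x, p (f x) = q (g x)) ->
    (forall x, f x = 0 -> g x = 0 -> x = 0) ->
    (forall y z, p y = q z -> exists2 x, f x = y & g x = z) ->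
  exists j : ghom K X, ses j g.
Proof.
move=> [iI pS ip] fg fg0 fgS.
have iK y : exists2 x, f x = i y & g x = 0.
  by apply: fgS; rewrite ghom0; apply/ip; exists y.
have [j jE] := choice (fun y => let: ex_intro2 x a b := iK y in
  ex_intro (fun x => f x = i y /\ g x = 0) x (conj a b)).
have fgI x y : f x = f y -> g x = g y -> x = y.
  by move=> fxy gxy; apply/subr0_eq/fg0; rewrite ghomB ?fxy ?gxy subrr.
unshelve eexists; first (exists j).
- move=> c u v; apply: fgI.
    by rewrite (hfunL f) !(proj1 (jE _)) (hfunL i).
  by rewrite (hfunL g) !(proj2 (jE _)) scaler0 addr0.
- move=> a v; apply: fgI.
    by rewrite hfun_act !(proj1 (jE _)) hfun_act.
  by rewrite hfun_act !(proj2 (jE _)) (lin0 (mactL _)).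
- move=> d v; apply: fgI.
    by rewrite hfun_deg !(proj1 (jE _)) hfun_deg.
  by rewrite hfun_deg !(proj2 (jE _)) (lin0 (hcL _ _)).
split=> [x y /= jxy|z|x] /=.
- by apply: iI; rewrite -!(proj1 (jE _)) jxy.
- by have [y yz] := pS (q z); have [x _ gx] := fgS _ _ yz; exists x.
- split=> [gx|[y <-]]; last by case: (jE y).
  have /ip[y iy] : p (f x) = 0 by rewrite fg gx ghom0.
  by exists y; apply: fgI; rewrite ?(proj1 (jE _)) ?(proj2 (jE _)).
Qed.

(** Schanuel's lemma: two covers of [M] have the pullback as a common extension,
    which splits off the other cover on either side. *)
Lemma pd_cover n K P M (i : ghom K P) (p : ghom P M) : ses i p ->
  projective P -> pd n K -> pd n.+1 M.
Proof.
move=> ip pP pdK K2 P2 i2 p2 pP2 ip2.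
have [X [f [g [fg fg0 fgS]]]] := pullback p p2.
have [j jg] := pullback_ses ip fg fg0 fgS.
have [|||j2 jf] := pullback_ses (q := p) (f := g) (g := f) ip2.
- by move=> x; rewrite fg.
- by move=> x gx fx; exact: fg0.
- by move=> y z yz; have [x] := fgS z y (esym yz); exists x.
by apply: (pd_retract (ses_retract jf pP)); exact: pd_ext0 jg _ pdK.
Qed.

Lemma pdS n M : pd n M -> pd n.+1 M.
Proof.
elim: n M => [|n IHn] M pdM K P i p pP ip.
  by apply: projective_retract pP; exact: ses_retract ip _.
by apply: IHn; exact: pdM ip.
Qed.

Lemma pd_leq m n M : (m <= n)%N -> pd m M -> pd n M.
Proof.
by move=> /subnK <- pdM; elim: (_ - _)%N => // d; exact: pdS.
Qed.

(** The two estimates are proved by a common induction: a pullback along a cover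
    of [N] reduces the second one to the first one in the same degree, and the
    kernels of covers reduce the first one to the second one in the previous
    degree. *)
Lemma pd_ses n :
  (forall K M N (i : ghom K M) (p : ghom M N), ses i p ->
     pd n K -> pd n N -> pd n M) /\
  (forall K M N (i : ghom K M) (p : ghom M N), ses i p ->
     pd n M -> pd n.+1 N -> pd n K).
Proof.
have step m : (forall K M N (i : ghom K M) (p : ghom M N), ses i p ->
     pd m K -> pd m N -> pd m M) ->
  forall K M N (i : ghom K M) (p : ghom M N), ses i p ->
     pd m M -> pd m.+1 N -> pd m K.
  move=> ext K M N i p ip pdM pdN.
  have [R [q [pR qS]]] := free_cover N; have [N1 [n1 nq]] := ses_ker qS.
  have [X [f [g [fg fg0 fgS]]]] := pullback p q.
  have [j jg] := pullback_ses ip fg fg0 fgS.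
  have [|||j2 jf] := pullback_ses (q := p) (f := g) (g := f) nq.
  - by move=> x; rewrite fg.
  - by move=> x gx fx; exact: fg0.
  - by move=> y z yz; have [x] := fgS z y (esym yz); exists x.
  apply: (pd_retract (ses_retract jg pR)); apply: ext jf _ pdM.
  exact: pdN nq.
elim: n => [|n [IH1 IH2]].
  suff ext : forall K M N (i : ghom K M) (p : ghom M N), ses i p ->
     pd 0 K -> pd 0 N -> pd 0 M by split=> //; exact: step.
  by move=> K M N i p ip pK pN; exact: (pd_ext0 ip pN).
suff ext : forall K M N (i : ghom K M) (p : ghom M N), ses i p ->
   pd n.+1 K -> pd n.+1 N -> pd n.+1 M by split=> //; exact: step.
move=> K M N i p ip pdK pdN M1 P j q pP jq.
have [N1 [r [a [b [rs ab]]]]] := ses_cover ip jq.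
by apply: IH2 ab _ pdK; exact: pdN rs.
Qed.

Lemma pd_ext n K M N (i : ghom K M) (p : ghom M N) : ses i p ->
  pd n K -> pd n N -> pd n M.
Proof. exact: (pd_ses n).1. Qed.

Lemma pd_quot n K M N (i : ghom K M) (p : ghom M N) : ses i p ->
  pd n K -> pd n.+1 M -> pd n.+1 N.
Proof.
move=> ip pdK pdM; have [P [q [pP qS]]] := free_cover M.
have [M1 [j jq]] := ses_ker qS.
have [N1 [r [a [b [rs ab]]]]] := ses_cover ip jq.
by apply: (pd_cover rs pP); apply: (pd_ext ab _ pdK);
  exact: (pdM _ _ j q pP jq).
Qed.

Lemma pd_bij n M N (f : ghom M N) : injective f -> surjective f ->
  pd n M -> pd n N.
Proof.
move=> fI fS; apply: pd_retract.
have [//|g gE] := ghom_lift (i := f) (f := gid N) fI.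
by exists g, f.
Qed.

(** A resolution of length [n] is a cover followed by a resolution of its kernel
    of length [n - 1]. *)
Lemma projdim_le_pd n M : projdim_le M n -> pd n M.
Proof.
elim: n M => [|n IHn] M [P [d [eps [pP P0 epsS eps0 d0]]]].
  apply: (@pd_bij 0 _ _ eps _ epsS (pP 0)); apply/ghom_injP => x /eps0[y <-].
  by rewrite (P0 1 isT y) ghom0.
have [K [i iep]] := ses_ker epsS; have [iI _ iE] := iep.
apply: (pd_cover iep (pP 0)); apply: IHn.
have [x|q qE] := ghom_lift (i := i) (f := d 0) iI.
  by apply/iE/eps0; exists x.
exists (fun i => P i.+1), (fun i => d i.+1), q; split=> //.
- by move=> j nj; apply: P0.
- move=> y; have /eps0[x dx] : eps (i y) = 0 by apply/iE; exists y.
  by exists x; apply: iI; rewrite qE.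
- move=> x; rewrite -d0 -qE; split=> [->|]; first exact: ghom0.
  by rewrite -(ghom0 i) => /iI.
Qed.

Lemma exists_zero : exists Z : gmod A, forall x : Z, x = 0.
Proof.
have [P _] : exists P : gmod A, True.
  by exists (@free_gmod k A void (fun=> 0) (fun=> 0) (fun z : void => lin0 (hcL (ggr A) 0))).
have [|Z [i [iI iE]]] := @exists_sub _ _ P [set 0].
  split=> [|a v /= ->|d v /= ->]; rewrite ?(lin0 (mactL _)) ?(lin0 (hcL _ _)) //.
  by split=> // c u v /= -> ->; rewrite scaler0 addr0.
by exists Z => x; apply: iI; rewrite ghom0; apply/iE; exists x.
Qed.

Lemma pd_projdim_le n M : pd n M -> projdim_le M n.
Proof.
elim: n M => [|n IHn] M pdM.
  have [Z Z0] := exists_zero.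
  exists (fun i => if i is _.+1 then Z else M).
  exists (fun i => gzero Z (if i is _.+1 then Z else M)), (gid M).
  split=> [[|i]||y|x|i x] //.
  - by move=> X Y g f gS; exists (gzero Z X) => x; rewrite [x]Z0 !ghom0.
  - by case=> // i _ x; exact: Z0.
  - by exists y.
  - by split=> [/= ->|[y <-]] //; exists 0.
  - by split=> _ //; exists 0; rewrite ghom0 [x]Z0.
have [P0 [p [pP pS]]] := free_cover M; have [K [i ip]] := ses_ker pS.
have [iI _ iE] := ip.
have [P [d [eps [proj P_0 epsS eps0 d0]]]] := IHn _ (pdM _ _ i p pP ip).
exists (fun i => if i is j.+1 then P j else P0).
exists (fun l => if l is j.+1 return
  ghom (P l) (if l is j.+1 then P j else P0) then d j else gcomp i eps), p.
split=> [[|j]|[|j]||x|[|j] x] //=.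
- by rewrite ltnS; exact: P_0.
- rewrite iE; split=> [[y <-]|[y <-]]; last by exists (eps y).
  by have [z <-] := epsS y; exists z.
- rewrite -eps0; split=> [|->]; last exact: ghom0.
  by rewrite -(ghom0 i) => /iI.
Qed.

End ProjectiveDimension.

(** * Corners of modules killed by an ideal *)

Section Killed.
Variables (k : fieldType) (A : lugalg k).

Definition killed (J : set A) (M : gmod A) : Prop :=
  forall a (v : M), J a -> mact a v = 0.

Lemma killed_sub J (K M : gmod A) (i : ghom K M) : injective i -> killed J M ->
  killed J K.
Proof. by move=> iI kM a v Ja; apply: iI; rewrite hfun_act kM // ghom0. Qed.

Lemma killed_quot J (M N : gmod A) (p : ghom M N) : surjective p -> killed J M ->
  killed J N.
Proof.
by move=> pS kM a y Ja; have [x <-] := pS y; rewrite -hfun_act kM // ghom0.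
Qed.

End Killed.

Section CornerModules.
Variables (k : fieldType) (A C : lugalg k) (e : A) (J : set A) (phi : A -> C).

(** [phi] identifies [C] with the corner [e (A / J) e], through [a |-> e a e].
    The conditions are invariant under passing to opposite algebras. *)
Record corner_map : Prop := CornerMap {
  cm_idem : e ⋆ e = e;
  cm_deg0 : has_degree (ggr A) 0 e;
  cm_lin : linear phi;
  cm_hc : forall d a, phi (hc (ggr A) d a) = hc (ggr C) d (phi a);
  cm_mulr : forall a b, a ⋆ e = a -> phi (a ⋆ b) = phi a ⋆ phi b;
  cm_mull : forall a b, e ⋆ b = b -> phi (a ⋆ b) = phi a ⋆ phi b;
  cm_surj : forall c, exists a, phi a = c;
  cm_ker : forall a, phi a = 0 <-> J (e ⋆ a ⋆ e);
  cm_one : exists i, gone C i = phi e }.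

Hypothesis cm : corner_map.

Lemma cm_J0 : J 0.
Proof.
have /(cm_ker cm) := lin0 (cm_lin cm).
by rewrite (lin0 (gmulL _)) (lin0 (gmulR _)).
Qed.

Lemma cm_sandwich a b : e ⋆ a ⋆ e = e ⋆ b ⋆ e -> phi a = phi b.
Proof.
move=> ab; apply/subr0_eq; rewrite -(linB (cm_lin cm)); apply/(cm_ker cm).
by rewrite (linB (gmulL _)) (linB (gmulR _)) ab subrr; exact: cm_J0.
Qed.

Lemma cm_el a : phi (e ⋆ a) = phi a.
Proof. by apply: cm_sandwich; rewrite gmulA cm_idem. Qed.

Lemma cm_lift c : exists a, [/\ phi a = c, e ⋆ a = a & a ⋆ e = a].
Proof.
have [a <-] := cm_surj cm c; exists (e ⋆ a ⋆ e); split.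
- by apply: cm_sandwich; rewrite !gmulA cm_idem // -!gmulA cm_idem.
- by rewrite !gmulA cm_idem.
- by rewrite -!gmulA cm_idem.
Qed.

Variable M : gmod A.
Hypothesis kM : killed J M.

Definition corner_set : set M := [set v | mact e v = v].

Lemma corner_act_uniq a b v : phi a = phi b -> e ⋆ a = a -> e ⋆ b = b ->
  corner_set v -> mact a v = mact b v.
Proof.
move=> ab ea eb ev; apply/subr0_eq; rewrite -(linB (mactR v)).
have -> : a - b = e ⋆ (a - b) by rewrite (linB (gmulL e)) ea eb.
rewrite -ev -mactA; apply: kM; apply/(cm_ker cm).
by rewrite (linB (cm_lin cm)) ab subrr.
Qed.

(** An element of [C] acts on [e M] through any lift to [e A]: two lifts differ by
    an element whose action on [e M] is that of an element of [J]. *)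
Definition corner_gmod_spec : {N : gmod C & {f : N -> M |
  [/\ injective f, linear f, forall v, corner_set v <-> exists x, f x = v,
      forall d x, f (hc (mgr N) d x) = hc (mgr M) d (f x) &
      forall a x, e ⋆ a = a -> f (mact (phi a) x) = mact a (f x)]}}.
Proof.
have [psi psiE] := choice cm_lift.
have ps c : phi (psi c) = c by have [] := psiE c.
have eps c : e ⋆ psi c = psi c by have [] := psiE c.
have Us : submodule corner_set.
  split=> [|c u v]; rewrite /corner_set /= ?(lin0 (mactL _)) //.
  by rewrite mactL => -> ->.
have act_uniq a c v : phi a = c -> e ⋆ a = a -> corner_set v ->
    mact (psi c) v = mact a v.
  by move=> ac ea ev; apply: corner_act_uniq => //; rewrite ps.
unshelve eexists.
  apply: (@sub_gmod _ C _ corner_set (hc (mgr M)) (fun c => mact (psi c)) Us).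
  - by move=> d v ev; rewrite /corner_set /= -(hc_mact0 _ _ (cm_deg0 cm)) ev.
  - exact: hcL.
  - exact: hcK.
  - by move=> v _; exact: hc_sum.
  - by move=> c v _; rewrite /corner_set /= -mactA eps.
  - by move=> c; exact: mactL.
  - move=> v ev t c c' /=; rewrite -(mactR v); apply: act_uniq => //.
      by rewrite (cm_lin cm) !ps.
    by rewrite (gmulL e) !eps.
  - move=> c c' v ev; rewrite -mactA; apply: act_uniq => //.
      by rewrite (cm_mull cm) ?eps // !ps.
    by rewrite gmulA eps.
  - move=> d n c v ev dc nv.
    rewrite (@act_uniq (hc (ggr A) d (psi c)) c v) //.
    + by apply: mact_deg => //; exact: hcKd.
    + by rewrite (cm_hc cm) ps.
    + by rewrite -(hc_mul0 _ _ (cm_deg0 cm)) eps.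
  - move=> v ev; have [i iE] := cm_one cm; exists [:: i] => //.
    rewrite big_seq1 iE (@act_uniq e) //; exact: cm_idem.
exists (fun x => val (x : ssort corner_set)); split.
- by move=> x y /val_inj.
- by [].
- move=> v; split=> [ev|[x <-]]; last exact: smemP.
  by exists (sin ev).
- by [].
- by move=> a x ea; exact: (act_uniq _ _ _ erefl ea (smemP x)).
Qed.

Definition corner_gmod : gmod C := projT1 corner_gmod_spec.
Definition cval : corner_gmod -> M := sval (projT2 corner_gmod_spec).

Lemma cval_inj : injective cval.
Proof. by have [] := svalP (projT2 corner_gmod_spec). Qed.
Lemma cvalL : linear cval.
Proof. by have [] := svalP (projT2 corner_gmod_spec). Qed.
Lemma cval_setP v : mact e v = v <-> exists x, cval x = v.
Proof. by have [_ _ /(_ v)] := svalP (projT2 corner_gmod_spec). Qed.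
Lemma cval_e x : mact e (cval x) = cval x.
Proof. by apply/cval_setP; exists x. Qed.
Lemma cval_hc d x : cval (hc (mgr corner_gmod) d x) = hc (mgr M) d (cval x).
Proof. by have [_ _ _ /(_ d x)] := svalP (projT2 corner_gmod_spec). Qed.
Lemma cval_act a x : e ⋆ a = a -> cval (mact (phi a) x) = mact a (cval x).
Proof. by have [_ _ _ _ /(_ a x)] := svalP (projT2 corner_gmod_spec). Qed.
Lemma cval_act_el a x : cval (mact (phi a) x) = mact e (mact a (cval x)).
Proof. by rewrite -cm_el cval_act ?mactA // gmulA cm_idem. Qed.

End CornerModules.

Arguments cvalL {k A C e J phi} cm {M} kM _ _ _.

Section CornerHoms.
Variables (k : fieldType) (A C : lugalg k) (e : A) (J : set A) (phi : A -> C).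
Hypothesis cm : corner_map e J phi.
Variables (M N : gmod A) (kM : killed J M) (kN : killed J N) (f : ghom M N).

Lemma corner_hom : exists g : ghom (corner_gmod cm kM) (corner_gmod cm kN),
  forall x, cval (g x) = f (cval x).
Proof.
have gP (x : corner_gmod cm kM) : exists y : corner_gmod cm kN, cval y = f (cval x).
  by apply/cval_setP; rewrite -hfun_act cval_e.
have [g gE] := choice gP.
unshelve eexists; first (exists g); last exact: gE.
- by move=> c u v; apply: cval_inj; rewrite cvalL !gE cvalL (hfunL f).
- move=> c v; apply: cval_inj; have [a [<- ea _]] := cm_lift cm c.
  by rewrite (cval_act _ ea) !gE (cval_act _ ea) hfun_act.
- by move=> d v; apply: cval_inj; rewrite cval_hc !gE cval_hc hfun_deg.
Qed.

End CornerHoms.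

Section CornerSes.
Variables (k : fieldType) (A C : lugalg k) (e : A) (J : set A) (phi : A -> C).
Hypothesis cm : corner_map e J phi.
Variables (K M N : gmod A) (kK : killed J K) (kM : killed J M) (kN : killed J N).
Variables (i : ghom K M) (p : ghom M N).

Lemma corner_ses :
    injective i -> (forall x, p x = 0 <-> exists y, i y = x) ->
    (forall v, mact e v = v -> exists x, p x = v) ->
  exists (j : ghom (corner_gmod cm kK) (corner_gmod cm kM))
    (q : ghom (corner_gmod cm kM) (corner_gmod cm kN)),
    (forall x, cval (q x) = p (cval x)) /\ ses j q.
Proof.
move=> iI ip pS.
have [j jE] := corner_hom cm kK kM i; have [q qE] := corner_hom cm kM kN p.
exists j, q; split=> //; split=> [x y jxy|y|x].
- by apply/cval_inj/iI; rewrite -!jE jxy.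
- have [x px] := pS _ (cval_e y).
  have /(cval_setP cm kM)[z zx] : mact e (mact e x) = mact e x.
    by rewrite -mactA (cm_idem cm).
  exists z; apply: cval_inj; rewrite qE zx hfun_act px; exact: cval_e.
- split=> [qx|[y <-]]; last first.
    apply: cval_inj; rewrite qE jE (lin0 (cvalL cm _)).
    by apply/ip; exists (cval y).
  have /ip[y iy] : p (cval x) = 0 by rewrite -qE qx (lin0 (cvalL cm _)).
  have /(cval_setP cm kK)[z zy] : mact e y = y.
    by apply: iI; rewrite hfun_act iy cval_e.
  by exists z; apply: cval_inj; rewrite jE zy.
Qed.

End CornerSes.

(** * Projective dimension across one layer *)

Section Layer.
Variables (k : fieldType) (A C : lugalg k) (J : set A).
Hypothesis Jsub : submodule J.
Hypothesis Jmull : forall a b, J b -> J (a ⋆ b).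
Hypothesis Jmulr : forall a b, J a -> J (a ⋆ b).
Hypothesis Jhc : forall d a, J a -> J (hc (ggr A) d a).

Lemma coef_submodule (Z : choiceType) (i : Z -> idx A) (d : Z -> int) :
  graded_submodule [set x : gfree i d | forall z, J (fcoef x z)].
Proof.
split=> [|a v /= vJ z|n v /= vJ z].
- split=> [z|c u v /= uJ vJ z]; first by case: Jsub.
  by rewrite fcoefL; case: Jsub => _; apply.
- by rewrite fcoef_act; exact: Jmull.
- by rewrite fcoef_hc; exact: Jhc.
Qed.

(** [Q] is the direct sum of the [A 1_(i z) / J 1_(i z)], shifted by [d z]. *)
Definition mod_coef (Z : choiceType) (i : Z -> idx A) (d : Z -> int) (Q : gmod A)
    (p : ghom (gfree i d) Q) : Prop :=
  surjective p /\ forall x, p x = 0 <-> forall z, J (fcoef x z).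

Lemma mod_coef_killed Z i d Q p : @mod_coef Z i d Q p -> killed J Q.
Proof.
move=> [pS pE] a y Ja; have [x <-] := pS y; rewrite -hfun_act; apply/pE => z.
by rewrite fcoef_act; exact: Jmulr.
Qed.

Variables (e : A) (phi : A -> C).
Hypothesis cm : corner_map e J phi.
Variables (I : choiceType) (s : I -> idx A).
Hypothesis e_gone : forall i, e ⋆ gone A (s i) = gone A (s i).
Hypothesis gone_e : forall i, gone A (s i) ⋆ e = gone A (s i).
Hypothesis e_sum : exists r : seq I, e = \sum_(i <- r) gone A (s i).

Variable n : nat.
Hypothesis pd_quotient : forall Z i d Q p, @mod_coef Z i d Q p -> pd n Q.
Hypothesis pd_above : forall M : gmod A, killed J M ->
  (forall i (v : M), mact (gone A (s i)) v = 0) -> pd n M.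

(** The image of [f] is controlled by [X] and [ker f], while the cokernel is
    killed by the [1_(s j)], so that the bound for the layers above applies. *)
Lemma pd_of_image b (X M K : gmod A) (f : ghom X M) (i : ghom K X) :
    killed J M -> (forall j (v : M), exists x, f x = mact (gone A (s j)) v) ->
    injective i -> (forall x, f x = 0 <-> exists y, i y = x) ->
    pd b K -> pd b X ->
  pd (maxn b.+1 n) M.
Proof.
move=> kM fs iI iE pdK pdX.
have [Im [p [m [mI pS mp]]]] := exists_im f.
have ip : ses i p.
  split=> // x; rewrite -iE -mp; split=> [->|]; first exact: ghom0.
  by rewrite -(ghom0 m) => /mI.
have [N [q [qS qE]]] := exists_quot (im_submodule f).
have mq : ses m q.
  split=> // x; rewrite qE; split=> [[y <-]|[y <-]]; first by exists (p y).
  by have [z <-] := pS y; exists z.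
apply: (pd_ext mq).
  by apply: (@pd_leq _ _ b.+1); [exact: leq_maxl | exact: pd_quot ip pdK (pdS pdX)].
apply: (@pd_leq _ _ n); first exact: leq_maxr.
apply: pd_above => [|j y]; first exact: killed_quot qS kM.
have [x <-] := qS y; rewrite -hfun_act; apply/qE.
by have [z fz] := fs j x; exists z.
Qed.

Section Cover.
Variable M : gmod A.
Hypothesis kM : killed J M.

Local Notation Z := (I * int * M)%type.
Local Notation ix := (@comp_idx _ A _ s M).
Local Notation dg := (@comp_deg _ A I M).

Variables (Q : gmod A) (pi : ghom (gfree ix dg) Q).
Hypothesis piE : mod_coef pi.

Definition qgen (z : Z) : Q := pi (ggen ix dg z).

Lemma qgen_idem z : mact (gone A (s z.1.1)) (qgen z) = qgen z.
Proof. by rewrite -hfun_act; congr (pi _); exact: fgen_e. Qed.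

Lemma qgen_deg z : has_degree (mgr Q) (dg z) (qgen z).
Proof.
rewrite /has_degree /= /qgen -hfun_deg; congr (pi _).
exact: (fgen_deg dg (fun z => gone_idem (ix z)) (fun z => gone_deg0 (ix z))).
Qed.

Lemma qgen_span x : exists (r : seq Z) (a : Z -> A),
  x = \sum_(z <- r) mact (a z) (qgen z).
Proof.
have [y <-] := piE.1 x; have [r [ur ry]] := fsupp_ex y.
exists r, (fcoef y).
rewrite {1}(fgen_sum (fun z => gone_idem (ix z)) ur ry) (lin_sum (hfunL pi)).
by apply: eq_bigr => z _; rewrite hfun_act.
Qed.

Lemma qgen_hom (N : gmod A) (w : Z -> N) : killed J N ->
    (forall z, mact (gone A (s z.1.1)) (w z) = w z) ->
    (forall z, has_degree (mgr N) (dg z) (w z)) ->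
  exists h : ghom Q N, forall z, h (qgen z) = w z.
Proof.
move=> kN we wd.
have [g gE] := free_hom (fun z => gone_deg0 (ix z)) we wd.
have [x px|h hE] := ghom_factor (f := g) piE.1.
  have [r [ur rx]] := fsupp_ex x; rewrite (gE _ _ ur rx) big1 // => z _.
  by apply: kN; move: z; apply/piE.2.
exists h => z; rewrite hE.
rewrite (gE _ [:: z]) // => [|z']; last first.
  by rewrite inE => /negPf zz'; rewrite fcoef_single zz'.
by rewrite big_seq1 fcoef_single eqxx we.
Qed.

Lemma qgen_ext (N : gmod A) (g h : ghom Q N) :
  (forall z, g (qgen z) = h (qgen z)) -> forall x, g x = h x.
Proof.
move=> gh x; have [r [a ->]] := qgen_span x.
rewrite (lin_sum (hfunL g)) (lin_sum (hfunL h)); apply: eq_bigr => z _.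
by rewrite !hfun_act gh.
Qed.

Lemma e_qgen z : mact e (qgen z) = qgen z.
Proof. by rewrite -(qgen_idem z) -mactA e_gone. Qed.

Let kQ : killed J Q := mod_coef_killed piE.

Definition cgen (z : Z) : corner_gmod cm kQ :=
  sval (cid ((cval_setP cm kQ _).1 (e_qgen z))).

Lemma cgenE z : cval (cgen z) = qgen z.
Proof. by rewrite /cgen; case: cid. Qed.

Lemma phi_idem z : phi (gone A (s z)) ⋆ phi (gone A (s z)) = phi (gone A (s z)).
Proof. by rewrite -(cm_mull cm) ?e_gone // gone_idem. Qed.

Lemma phi_deg0 z : has_degree (ggr C) 0 (phi (gone A (s z))).
Proof.
by rewrite /has_degree /= -(cm_hc cm); congr phi; exact: gone_deg0.
Qed.

Lemma cgen_idem z : mact (phi (gone A (s z.1.1))) (cgen z) = cgen z.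
Proof. by apply: cval_inj; rewrite cval_act ?cgenE ?qgen_idem. Qed.

Lemma cgen_deg z : has_degree (mgr (corner_gmod cm kQ)) (dg z) (cgen z).
Proof. by apply: cval_inj; rewrite cval_hc cgenE; exact: qgen_deg. Qed.

(** [e Q] is a direct sum of shifts of the projectives [C phi(1_(s i))]. *)
Lemma corner_cover_projective : projective (corner_gmod cm kQ).
Proof.
pose FC := free_gmod dg (fun z : Z => phi_deg0 z.1.1).
have FCp : projective FC by apply: free_projective => z; exact: phi_idem.
have [h hE] := free_homg (fun z : Z => phi_idem z.1.1)
  (fun z : Z => phi_deg0 z.1.1) cgen_idem cgen_deg.
apply: (@pd_bij _ _ 0 _ _ h _ _ FCp).
  apply/ghom_injP => x hx.
  have [r [ur rx]] := fsupp_ex x.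
  have [psi psiE] := choice (fun z => cm_lift cm (fcoef x z)).
  pose y : gfree ix dg := \sum_(z <- r) mact (psi z) (ggen ix dg z).
  have py : pi y = 0.
    rewrite /y (lin_sum (hfunL pi)).
    have := congr1 (@cval _ _ _ _ _ _ cm _ kQ) hx.
    rewrite {1}(fgen_sum (fun z : Z => phi_idem z.1.1) ur rx) (lin_sum (hfunL h)).
    rewrite (lin_sum (cvalL cm kQ)) (lin0 (cvalL cm kQ)) => hx0; rewrite -[RHS]hx0.
    apply: eq_bigr => z _; have [pz epz _] := psiE z.
    by rewrite !hfun_act hE -pz cval_act ?cgenE.
  apply: fcoef_inj; apply/funext => z; case: (boolP (z \in r)) => zr; last exact: rx.
  have /piE.2 /(_ z) := py.
  rewrite /y fcoef_sum (bigD1_seq z) //= big1 ?addr0 => [|z' zz']; last first.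
    by rewrite fcoef_act fcoef_single eq_sym (negPf zz') (lin0 (gmulL _)).
  have [pz epz _] := psiE z.
  rewrite fcoef_act fcoef_single eqxx -(fcoef_e x z) -pz -(cm_mulr cm); last first.
    by have [] := psiE z.
  move=> Jz; apply/(cm_ker cm).
  by rewrite gmulA epz -gmulA gone_e.
move=> y; have [r [a yE]] := qgen_span (cval y).
exists (\sum_(z <- r) mact (phi (a z)) (fgen (fun z : Z => phi_idem z.1.1)
  (fun z : Z => phi_deg0 z.1.1) z)).
apply: cval_inj; rewrite (lin_sum (hfunL h)) (lin_sum (cvalL cm kQ)).
rewrite -[RHS]cval_e yE (lin_sum (mactL _)); apply: eq_bigr => z _.
by rewrite hfun_act hE cval_act_el cgenE.
Qed.

Variable p : ghom Q M.
Hypothesis pE : forall z, p (qgen z) = comp_vec s z.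

Lemma cover_gone i v : exists x, p x = mact (gone A (s i)) v.
Proof.
have [imS _ _] := im_submodule p.
by apply: (comp_vec_submodule (s := s) imS) => z; exists (qgen z).
Qed.

Lemma cover_corner v : mact e v = v -> exists x, p x = v.
Proof.
move=> <-; have [r ->] := e_sum; rewrite (lin_sum (mactR v)).
have [imS _ _] := im_submodule p.
by apply: (submodule_sum imS) => i _; exact: cover_gone.
Qed.

(** A splitting [sigma] of the cover [e Q -> e M] extends to the idempotent
    endomorphism [tau] of [Q] sending each generator to the image under [sigma]
    of its image in [M].  Its image is a summand of [Q] which maps to [M] with
    kernel and cokernel killed by [e]. *)
Lemma pd_projective_corner : projective (corner_gmod cm kM) ->
  pd (maxn n.+1 n) M.
Proof.
move=> eM_proj.
have [K [i [iI iE]]] := exists_ker p.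
have [_ [ep [epE [_ epS _]]]] :=
  corner_ses cm (killed_sub iI kQ) kQ kM iI iE cover_corner.
have [sigma sE] := projective_split eM_proj epS.
have comp_e (z : Z) : mact e (comp_vec s z) = comp_vec s z.
  by rewrite -(comp_vec_idem s z) -mactA e_gone.
have [cv cvE] := choice (fun z : Z => (cval_setP cm kM _).1 (comp_e z)).
pose w (z : Z) := cval (sigma (cv z)).
have [z|z|tau tauE] := qgen_hom (w := w) kQ.
- rewrite /w -cval_act // -hfun_act; congr (cval (sigma _)).
  by apply: cval_inj; rewrite cval_act // cvE comp_vec_idem.
- rewrite /has_degree /= /w -cval_hc -hfun_deg; congr (cval (sigma _)).
  by apply: cval_inj; rewrite cval_hc cvE; exact: comp_vec_deg.
have p_tau x : p (tau x) = p x.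
  apply: (qgen_ext (g := gcomp p tau) (h := p)) => z /=.
  by rewrite tauE /w -epE sE cvE pE.
have tau_c y : tau (cval y) = cval (sigma (ep y)).
  have [r [a yE]] := qgen_span (cval y).
  have epy : ep y = \sum_(z <- r) mact (phi (a z)) (cv z).
    apply: cval_inj; rewrite epE -(cval_e y) yE !(lin_sum (mactL _), lin_sum (hfunL _)).
    rewrite (lin_sum (cvalL cm kM)); apply: eq_bigr => z _.
    by rewrite cval_act_el cvE !hfun_act pE.
  rewrite epy -(cval_e y) yE !(lin_sum (mactL _), lin_sum (hfunL _)).
  rewrite (lin_sum (cvalL cm kQ)); apply: eq_bigr => z _.
  by rewrite !hfun_act tauE cval_act_el.
have tauK x : tau (tau x) = tau x.
  apply: (qgen_ext (g := gcomp tau tau) (h := tau)) => z /=.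
  by rewrite tauE /w tau_c sE.
have [X [r [j [jI rS jr]]]] := exists_im tau.
have rj x : r (j x) = x.
  by have [y <-] := rS x; apply: jI; rewrite !jr tauK.
have pdX : pd n X by apply: (pd_retract _ (pd_quotient piE)); exists j, r.
have [L [l [lI lE]]] := exists_ker (gcomp p j).
apply: (pd_of_image (f := gcomp p j) (i := l)) => //.
  move=> b v; have [x px] := cover_gone b v; exists (r x).
  by rewrite /= jr p_tau.
apply: pd_above.
  by apply: killed_sub lI _; exact: killed_sub jI kQ.
move=> b y; set x := mact _ y.
have px : p (j (l x)) = 0 by apply/lE; exists x.
have tx : tau (j (l x)) = j (l x) by rewrite -jr rj.
have ex : mact e (j (l x)) = j (l x).
  by rewrite /x !hfun_act -mactA e_gone.
have [u uE] := (cval_setP cm kQ _).1 ex.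
apply: lI; apply: jI; rewrite !ghom0 -tx -uE tau_c.
have -> : ep u = 0.
  by apply: cval_inj; rewrite epE uE px (lin0 (cvalL cm kM)).
by rewrite ghom0 (lin0 (cvalL cm kQ)).
Qed.

End Cover.

(** Dimension shifting along the covers [e Q -> e M] reduces the bound to modules
    whose corner is projective. *)
Lemma pd_corner m : exists b, forall (M : gmod A) (kM : killed J M),
  pd m (corner_gmod cm kM) -> pd b M.
Proof.
have cover (M : gmod A) : killed J M -> exists (Q : gmod A)
    (pi : ghom (gfree (@comp_idx _ A _ s M) (@comp_deg _ A I M)) Q)
    (piE : mod_coef pi) (p : ghom Q M),
    forall z, p (qgen pi z) = comp_vec s z.
  move=> kM; have [Q [pi piE]] :=
    exists_quot (coef_submodule (@comp_idx _ A _ s M) (@comp_deg _ A I M)).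
  have [p pE] := qgen_hom piE kM (comp_vec_idem s (M := M)) (comp_vec_deg s (M := M)).
  by exists Q, pi, piE, p.
elim: m => [|m [b IHm]].
  exists (maxn n.+1 n) => M kM pM; have [Q [pi [piE [p pE]]]] := cover M kM.
  exact: pd_projective_corner pE pM.
exists (maxn (maxn b n).+1 n) => M kM pdM.
have [Q [pi [piE [p pE]]]] := cover M kM.
have [K [i [iI iE]]] := exists_ker p.
have kQ := mod_coef_killed piE; have kK := killed_sub iI kQ.
have [j [q [_ jq]]] := corner_ses cm kK kQ kM iI iE (cover_corner pE).
apply: (pd_of_image (f := p) (i := i)) => //.
- exact: cover_gone pE.
- apply: (@pd_leq _ _ b); first exact: leq_maxl.
  apply: (IHm _ kK); apply: pdM jq.
  by rewrite (Prop_irrelevance kQ (mod_coef_killed piE)); exact: corner_cover_projective.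
- by apply: (@pd_leq _ _ n); [exact: leq_maxr | exact: pd_quotient piE].
Qed.

Lemma pd_layer : (exists m, left_gldim_le C m) ->
  exists b, forall M : gmod A, killed J M -> pd b M.
Proof.
move=> [m Cm]; have [b bE] := pd_corner m; exists b => M kM.
by apply: (bE _ kM); apply: projdim_le_pd; exact: Cm.
Qed.

End Layer.

(** * Ideals spanned by basis elements of given weights *)

Section LinearExtension.
Variables (k : fieldType) (J : choiceType) (D : set J) (V W : lmodType k).
Variables (f : J -> V) (g : J -> W).

Lemma collect_sum (X : lmodType k) (s : seq (J * k)) (h : J -> X) :
  \sum_(p <- s) p.2 *: h p.1 =
  \sum_(j <- undup (map fst s)) (\sum_(p <- s | p.1 == j) p.2) *: h j.
Proof.
under [RHS]eq_bigr do rewrite scaler_suml.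
rewrite (exchange_big_dep xpredT) //= big_seq [RHS]big_seq.
apply: eq_bigr => p ps; rewrite -big_filter.
have : perm_eq [seq j <- undup (map fst s) | p.1 == j] [:: p.1].
  apply: uniq_perm => // [|j]; first by rewrite filter_uniq ?undup_uniq.
  rewrite mem_filter inE mem_undup eq_sym; case: eqP => // ->.
  by rewrite map_f.
by move=> /(perm_big _) ->; rewrite big_seq1.
Qed.

(** The graph of [G] is the set of pairs of combinations with equal coefficients;
    independence makes it functional. *)
Lemma basis_ext : is_basis D f ->
  exists G : V -> W, linear G /\ forall j, D j -> G (f j) = g j.
Proof.
move=> [free gen].
pose R v w := exists s : seq (J * k), [/\ forall p, p \in s -> D p.1,
  v = \sum_(p <- s) p.2 *: f p.1 & w = \sum_(p <- s) p.2 *: g p.1].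
have RL c v w v' w' : R v w -> R v' w' -> R (c *: v + v') (c *: w + w').
  move=> [s [sD -> ->]] [t [tD -> ->]].
  exists (map (fun p => (p.1, c * p.2)) s ++ t); split.
  - by move=> p; rewrite mem_cat => /orP[/mapP[q qs ->]|]; [exact: (sD q) | exact: tD].
  - rewrite big_cat big_map scaler_sumr /=; congr (_ + _).
    by apply: eq_bigr => p _; rewrite scalerA.
  - rewrite big_cat big_map scaler_sumr /=; congr (_ + _).
    by apply: eq_bigr => p _; rewrite scalerA.
have R0 w : R 0 w -> w = 0.
  move=> [s [sD + ->]]; rewrite !collect_sum => /esym s0.
  rewrite big_seq big1 // => j js; rewrite (free _ _ (undup_uniq _) _ s0 j js) ?scale0r //.
  by move=> i /=; rewrite mem_undup => /mapP[p ps ->]; move: (sD p ps).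
have Rfun v w w' : R v w -> R v w' -> w = w'.
  move=> vw vw'; apply/subr0_eq/R0; have := RL (-1) _ _ _ _ vw' vw.
  by rewrite !scaleN1r addNr addrC.
have Rtot v : exists w, R v w.
  have [s [c [sD ->]]] := gen v.
  exists (\sum_(j <- s) c j *: g j), (map (fun j => (j, c j)) s).
  by split=> [p /mapP[j js ->]||]; rewrite ?big_map //; exact: (sD j).
have [G GE] := choice Rtot; exists G; split=> [c u v|j Dj].
  by apply: Rfun (GE _) _; exact: RL.
apply: Rfun (GE _) _; exists [:: (j, 1)]; rewrite !big_seq1 !scale1r.
by split=> // p; rewrite inE => /eqP->.
Qed.

End LinearExtension.

Section Span.
Variables (k : fieldType) (V : lmodType k).

Definition span (E : set V) : set V :=
  [set v | forall U : set V, submodule U -> E `<=` U -> U v].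

Lemma span_submodule E : submodule (span E).
Proof.
split=> [U [U0 _]|c u v uE vE U Us EU] //.
by case: (Us) => _; apply; [exact: uE | exact: vE].
Qed.

Lemma sub_span E : E `<=` span E.
Proof. by move=> v Ev U _; exact. Qed.

Lemma span_ind (U E : set V) : submodule U -> E `<=` U -> span E `<=` U.
Proof. by move=> Us EU v; exact. Qed.

Lemma submodule_preim (W : lmodType k) (f : W -> V) (U : set V) : linear f ->
  submodule U -> submodule [set w | U (f w)].
Proof.
move=> fL [U0 UL]; split=> [|c u v Uu Uv] /=; first by rewrite (lin0 fL).
by rewrite fL; exact: UL.
Qed.

End Span.

Section WeightIdeals.
Variables (k : fieldType) (A : lugalg k) (disp : Order.disp_t).
Variables (L : porderType disp) (T : triangular_basis A L).
Implicit Types (s t : tS T) (G : set L).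

Lemma lt_wf : well_founded (fun m l : L => (m < l)%O).
Proof.
suff main n : forall (r : seq L) l, (size r < n)%N ->
    (forall m, (m <= l)%O -> m \in r) -> Acc (fun m l : L => (m < l)%O) l.
  move=> l; have /finite_seqP[r rE] := weight_lower_finite T l.
  apply: (main (size r).+1 r) => // m ml.
  by have : [set` r] m by rewrite -rE.
elim: n => [|n IHn] r l; first by rewrite ltn0.
move=> rn lr; constructor=> m ml; apply: (IHn (rem l r)).
  by move: rn; rewrite (perm_size (perm_to_rem (lr l (lexx l)))).
move=> q qm; have ql := le_lt_trans qm ml.
have := lr q (ltW ql); rewrite (perm_mem (perm_to_rem (lr l (lexx l)))) inE.
by rewrite lt_eqF.
Qed.

Definition wbasis G : set A := [set a | exists i s t j x h y,
  [/\ tX i s x, tH s t h, tY t j y, G (dot s) & a = x ⋆ h ⋆ y]].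

Definition wspan G : set A := span (wbasis G).

Lemma wspan_sub G : submodule (wspan G).
Proof. exact: span_submodule. Qed.

Lemma wspan_mono G H : G `<=` H -> wspan G `<=` wspan H.
Proof.
move=> GH; apply: span_ind; first exact: wspan_sub.
move=> a [i [s [t [j [x [h [y [Xx Hh Yy Gs ->]]]]]]]]; apply: sub_span.
by exists i, s, t, j, x, h, y; split=> //; exact: GH.
Qed.

Lemma wspan0 a : wspan set0 a -> a = 0.
Proof.
move=> /(_ [set 0]); apply.
  by split=> // c u v /= -> ->; rewrite scaler0 addr0.
by move=> b [i [s [t [j [x [h [y [_ _ _ []]]]]]]]].
Qed.

Lemma wspanT a : wspan setT a.
Proof.
have [_ /(_ a)[r [c [rD ->]]]] := tA1 T.
apply: (submodule_sum_seq (wspan_sub _)) => p /rD[s [t [[i Xx] Hh [j Yy]]]].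
apply: (submoduleZ _ (wspan_sub _)).
by apply: sub_span; exists i, s, t, j, p.1.1, p.1.2, p.2.
Qed.

Lemma algebra_ind (U : set A) : submodule U ->
  (forall i s t j x h y, tX i s x -> tH s t h -> tY t j y -> U (x ⋆ h ⋆ y)) ->
  forall a, U a.
Proof.
move=> Us UX a; apply: (span_ind Us _ (wspanT a)).
by move=> _ [i [s [t [j [x [h [y [Xx Hh Yy _ ->]]]]]]]]; exact: UX Xx Hh Yy.
Qed.

Lemma pieceP i j (a : A) : piece i j a -> gone A i ⋆ a = a /\ a ⋆ gone A j = a.
Proof.
move=> [b _ <-]; split; first by rewrite !gmulA gone_idem.
by rewrite -!gmulA gone_idem.
Qed.

Lemma tXl i s x : tX i s x -> gone A i ⋆ x = x.
Proof. by move=> /tX_sub[/pieceP[]]. Qed.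
Lemma tXr i s x : tX i s x -> x ⋆ gone A (val s) = x.
Proof. by move=> /tX_sub[/pieceP[]]. Qed.
Lemma tHl s t h : tH s t h -> gone A (val s) ⋆ h = h.
Proof. by move=> /tH_sub[/pieceP[]]. Qed.
Lemma tHr s t h : tH s t h -> h ⋆ gone A (val t) = h.
Proof. by move=> /tH_sub[/pieceP[]]. Qed.
Lemma tYl t j y : tY t j y -> gone A (val t) ⋆ y = y.
Proof. by move=> /tY_sub[/pieceP[]]. Qed.
Lemma tYr t j y : tY t j y -> y ⋆ gone A j = y.
Proof. by move=> /tY_sub[/pieceP[]]. Qed.

Lemma gone_tX l i s x : tX i s x ->
  gone A l ⋆ x = if l == i then x else 0.
Proof. by move=> Xx; rewrite -{1}(tXl Xx) gone_mull (tXl Xx). Qed.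

Lemma tY_gone l t j y : tY t j y ->
  y ⋆ gone A l = if l == j then y else 0.
Proof.
move=> Yy; rewrite -{1}(tYr Yy) -gmulA gone_orth eq_sym.
by case: eqP => _; rewrite ?(lin0 (gmulL _)) ?(tYr Yy).
Qed.

Lemma tH_weight s t h : tH s t h -> dot s = dot t.
Proof.
move=> Hh; have [->//|/eqP st] := eqVneq s t.
by have [_ + _] := tA3 st; apply; exists h.
Qed.

Lemma tX_weight s t x : tX (val s) t x ->
  (dot t < dot s)%O \/ (t = s /\ x = gone A (val s)).
Proof.
move=> Xx; have [st|/eqP st] := eqVneq s t.
  by right; have [XE _] := tA2 s; move: Xx; rewrite -st XE.
by left; have [+ _ _] := tA3 st; apply; exists x.
Qed.

Lemma tY_weight s t y : tY t (val s) y ->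
  (dot t < dot s)%O \/ (t = s /\ y = gone A (val s)).
Proof.
move=> Yy; have [st|/eqP st] := eqVneq t s.
  by right; have [_ YE] := tA2 s; move: Yy; rewrite st YE.
by left; have [_ _ +] := tA3 st; apply; exists y.
Qed.

(** Triangularity: multiplying basis elements through [1_s] only produces weights
    at most [dot s].  A factor [x] or [y] other than an idempotent passes through
    an idempotent of smaller weight; between idempotents, the product of two
    elements of the middle sets is expanded in the basis once more. *)
Lemma gone_wspan s a b : wspan [set m | (m <= dot s)%O] (a ⋆ gone A (val s) ⋆ b).
Proof.
elim/(well_founded_ind lt_wf): (dot s) {-2}s (erefl (dot s)) a b => l IH {}s sl.
rewrite sl; set W := wspan _; have Ws : submodule W by exact: wspan_sub.
have W0 : W 0 by case: Ws.
have below t a b : (dot t < l)%O -> W (a ⋆ gone A (val t) ⋆ b).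
  move=> tl; apply: wspan_mono (IH _ tl t erefl a b) => m /= mt.
  exact: ltW (le_lt_trans mt tl).
have middle i s1 t2 j x c y : tX i s1 x -> tY t2 j y -> dot s1 = l ->
    dot t2 = l ->
    W (x ⋆ (gone A (val s1) ⋆ c ⋆ gone A (val t2)) ⋆ y).
  move=> Xx Yy s1l t2l; move: c; apply: algebra_ind.
    apply: (submodule_preim (f := fun c => _)) => // u c c'.
    by rewrite gmulL gmulR gmulL gmulR.
  move=> i' s3 t3 j' x' h' y' Xx' Hh' Yy'.
  rewrite !gmulA -(gmulA x) (gone_tX _ Xx'); case: eqP => [i'E|_]; last first.
    by rewrite (lin0 (gmulL _)) !(lin0 (gmulR _)).
  rewrite -(gmulA _ y') (tY_gone _ Yy'); case: eqP => [j'E|_]; last first.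
    by rewrite (lin0 (gmulL _)) !(lin0 (gmulR _)).
  subst i' j'.
  have [lt3|[t3E y'E]] := tY_weight Yy'.
    rewrite -(tYl Yy') !gmulA -(gmulA _ y'); apply: below.
    by rewrite -t2l.
  have [lt3|[s3E x'E]] := tX_weight Xx'.
    rewrite -(tXr Xx') !gmulA -!(gmulA (_ ⋆ gone A (val s3))); apply: below.
    by rewrite -s1l.
  subst t3 s3 x' y'; rewrite (tXr Xx) -!gmulA (tYl Yy) gmulA.
  by apply: sub_span; exists i, s1, t2, j, x, h', y; split=> //=; rewrite s1l.
move=> a b; move: a; apply: algebra_ind.
  apply: (submodule_preim (f := fun c => _)) => // u c c'.
  by rewrite !gmulR.
move=> i s1 t j x h y Xx Hh Yy; move: b; apply: algebra_ind.
  by apply: (submodule_preim (f := fun c => _)) => //; exact: gmulL.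
move=> i' s2 t2 j' x' h' y' Xx' Hh' Yy'.
rewrite -(gmulA _ y) (tY_gone _ Yy); case: eqP => [jE|_]; last first.
  by rewrite (lin0 (gmulL _)) !(lin0 (gmulR _)).
subst j; have [lt1|[tE yE]] := tY_weight Yy.
  by rewrite -(tYl Yy) !gmulA -!(gmulA (_ ⋆ gone A (val t))); apply: below; rewrite -sl.
subst t y; rewrite !gmulA -(gmulA _ (gone A (val s)) x') (gone_tX _ Xx').
case: eqP => [i'E|_]; last by rewrite (lin0 (gmulL _)) !(lin0 (gmulR _)).
subst i'; have [lt2|[s2E x'E]] := tX_weight Xx'.
  rewrite -(tXr Xx') !gmulA -!(gmulA (_ ⋆ gone A (val s2))); apply: below.
  by rewrite -sl.
subst s2 x'.
have := middle i s1 t2 j' x (h ⋆ h') y' Xx Yy'.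
rewrite (tH_weight Hh) -(tH_weight Hh') sl => /(_ erefl erefl).
rewrite [X in x ⋆ X](_ : _ = h ⋆ h'); last first.
  by rewrite gmulA (tHl Hh) -gmulA (tHr Hh').
by rewrite !gmulA -(gmulA x h (gone A _)) (tHr Hh).

Qed.

Definition lower G : Prop := forall l m : L, (m <= l)%O -> G l -> G m.

Lemma wspan_gone G s a b : lower G -> G (dot s) ->
  wspan G (a ⋆ gone A (val s) ⋆ b).
Proof.
move=> Gl Gs.
have sG : [set m | (m <= dot s)%O] `<=` G by move=> m /= ms; exact: Gl ms Gs.
exact: (wspan_mono sG (gone_wspan a b)).
Qed.

Lemma wspan_mull G a b : lower G -> wspan G b -> wspan G (a ⋆ b).
Proof.
move=> Gl; move: b; apply: span_ind.
  by apply: submodule_preim; [exact: gmulL | exact: wspan_sub].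
move=> _ [i [s [t [j [x [h [y [Xx Hh Yy Gs ->]]]]]]]] /=.
by rewrite -(tXr Xx) !gmulA -(gmulA _ h); exact: wspan_gone.
Qed.

Lemma wspan_mulr G a b : lower G -> wspan G a -> wspan G (a ⋆ b).
Proof.
move=> Gl; move: a; apply: (span_ind (U := [set a | wspan G (a ⋆ b)])).
  exact: (submodule_preim (gmulR b) (wspan_sub G)).
move=> _ [i [s [t [j [x [h [y [Xx Hh Yy Gs ->]]]]]]]] /=.
by rewrite -(tXr Xx) -!gmulA (gmulA h) gmulA; exact: wspan_gone.
Qed.

Lemma wspan_hc G d a : wspan G a -> wspan G (hc (ggr A) d a).
Proof.
move: a; apply: span_ind.
  by apply: submodule_preim; [exact: hcL | exact: wspan_sub].
move=> a aG /=; have [i [s [t [j [x [h [y [Xx Hh Yy Gs aE]]]]]]]] := aG.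
have [_ [dx Dx]] := tX_sub Xx; have [_ [dh Dh]] := tH_sub Hh.
have [_ [dy Dy]] := tY_sub Yy.
have Da : has_degree (ggr A) (dx + dh + dy) a.
  by rewrite aE; apply: gmul_deg => //; exact: gmul_deg.
rewrite (deg_eq d Da); case: eqP => _; last by case: (wspan_sub G).
exact: sub_span.
Qed.

Lemma wspan_killed G (M : gmod A) :
  (forall s, G (dot s) -> forall v : M, mact (gone A (val s)) v = 0) ->
  killed (wspan G) M.
Proof.
move=> GM a v; move: a; apply: (span_ind (U := [set a | mact a v = 0])).
  split=> [|c u w /= u0 w0]; first exact: (lin0 (mactR v)).
  by rewrite /= mactR u0 w0 scaler0 addr0.
move=> _ [i [s [t [j [x [h [y [Xx Hh Yy Gs ->]]]]]]]] /=.
by rewrite -(tXr Xx) !mactA GM // (lin0 (mactL _)).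
Qed.

End WeightIdeals.

(** * The filtration by weights *)

Section Filtration.
Variables (k : fieldType) (A : lugalg k) (disp : Order.disp_t).
Variables (L : porderType disp) (T : triangular_basis A L).
Implicit Types (s t : tS T) (G : set L).

(** The finite lower sets, built by adding weights in some linear order
    extending the given one. *)
Inductive filtered : set L -> nat -> Prop :=
| filtered0 : filtered set0 0
| filteredS G n l : filtered G n -> ~ G l -> (forall m, (m < l)%O -> G m) ->
    filtered (l |` G) n.+1.

Lemma filtered_lower G n : filtered G n -> lower G.
Proof.
elim=> // {}G {}n l _ IH Gl lG a b ba [/= al|Ga]; last by right; exact: IH ba Ga.
subst a; move: ba; rewrite le_eqVlt => /predU1P[->|bl]; first by left.
by right; exact: lG.
Qed.

Lemma filtered_extend G n l : filtered G n ->
  exists H m, [/\ filtered H m, G `<=` H & H l].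
Proof.
elim/(well_founded_ind (lt_wf T)): l G n => l IH G n Gn.
have /finite_seqP[r rE] := weight_lower_finite T l.
have : exists H m, [/\ filtered H m, G `<=` H & forall q, q \in r -> (q < l)%O -> H q].
  elim: r {rE} => [|q r [H [m [Hm GH Hr]]]]; first by exists G, n; split.
  have [ql|ql] := boolP (q < l)%O; last first.
    exists H, m; split=> // p; rewrite inE => /predU1P[->|/Hr//].
    by rewrite (negPf ql).
  have [K [m' [Km HK Kq]]] := IH _ ql H m Hm.
  exists K, m'; split=> // [p /GH/HK//|p]; rewrite inE => /predU1P[->//|pr pl].
  exact/HK/Hr.
move=> [H [m [Hm GH Hl]]].
have [Hll|nHl] := pselect (H l); first by exists H, m.
exists (l |` H), m.+1; split.
- apply: filteredS => // q ql; apply: Hl => //.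
  by have : [set m | (m <= l)%O] q by [exact: ltW]; rewrite rE.
- by move=> p /GH; right.
- by left.
Qed.

(** An element involves finitely many basis elements, and the weights below them
    form a finite set. *)
Lemma wspan_filtered a : exists G n, filtered G n /\ wspan T G a.
Proof.
apply: (algebra_ind (T := T) (U := [set a | exists G n, filtered G n /\ wspan T G a])).
  split=> [|c u v [G [n [Gn uG]]] [H [m [Hm vH]]]].
    by exists set0, 0%N; split; [exact: filtered0 | case: (wspan_sub T set0)].
  suff [K [q [Kq GK HK]]] : exists K q, [/\ filtered K q, G `<=` K & H `<=` K].
    exists K, q; split=> //; have [_ KL] := wspan_sub T K.
    by apply: KL; [exact: (wspan_mono GK uG) | exact: (wspan_mono HK vH)].
  elim: Hm {uG vH} => [|{}H p l _ [K [q [Kq GK HK]]] _ _]; first by exists G, n; split.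
  have [K' [q' [Kq' KK' Kl]]] := filtered_extend l Kq.
  exists K', q'; split=> // [m' /GK/KK'//|m' [->//|/HK/KK'//]].
move=> i s t j x h y Xx Hh Yy.
have [G [n [Gn _ Gs]]] := filtered_extend (dot s) filtered0.
exists G, n; split=> //; apply: sub_span.
by exists i, s, t, j, x, h, y.
Qed.

Section Step.
Variables (G : set L) (l : L).
Hypotheses (Glow : lower G) (Gbelow : forall m, (m < l)%O -> G m).

Local Notation W := (wspan T G).

Let Wsub : submodule W. Proof. exact: wspan_sub. Qed.

(** Modulo the weights in [G], the layer of weight [l] has the basis [x h y], so
    reading off the factor in front of a given [y] is well defined there; [rho]
    is a linear extension of this operation to [A]. *)
Lemma right_division t (y : A) : exists rho : A -> A,
  [/\ linear rho, forall a, W a -> rho a = 0 &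
      forall t' j y' a, dot t' = l -> tY t' j y' -> a ⋆ gone A (val t') = a ->
        W (rho (a ⋆ y') - (if (t == t') && (y == y') then a else 0))].
Proof.
(* A triple may have several weights only if x = 0; then both values of rho
   agree modulo W, so that it is harmless to give priority to the weights in G. *)
pose low (p : A * A * A) := exists i s t j,
  [/\ tX i s p.1.1, tH s t p.1.2, tY t j p.2 & G (dot s)].
pose g (p : A * A * A) : A := if `[< low p >] then 0 else
  if y == p.2 then p.1.1 ⋆ p.1.2 ⋆ gone A (val t) else 0.
have [rho [rhoL rhoE]] := basis_ext g (tA1 T).
have rho_xhy i s t' j x h y' : tX i s x -> tH s t' h -> tY t' j y' ->
    rho (x ⋆ h ⋆ y') = g (x, h, y').
  move=> Xx Hh Yy; rewrite -(rhoE (x, h, y')) //=.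
  by exists s, t'; split=> //; [exists i | exists j].
have rho0 a : W a -> rho a = 0.
  move: a; apply: (span_ind (U := [set a | rho a = 0])).
    by split=> [|c u v /= u0 v0]; rewrite /= ?(lin0 rhoL) // rhoL u0 v0 scaler0 addr0.
  move=> _ [i [s [t' [j [x [h [y' [Xx Hh Yy Gs ->]]]]]]]] /=.
  rewrite (rho_xhy _ _ _ _ _ _ _ Xx Hh Yy) /g asboolT //.
  by exists i, s, t', j.
exists rho; split=> // t' j y' a t'l Yy' <-; move: a; apply: (algebra_ind (T := T)).
  set b := (t == t') && (y == y').
  apply: (submodule_preim (f := fun a : A => rho (a ⋆ gone A (val t') ⋆ y') -
    (if b then a ⋆ gone A (val t') else 0))) => // c u v.
  rewrite !gmulR rhoL; case: b; last by rewrite !subr0.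
  by rewrite opprD addrACA scalerBr.
move=> i s t1 j1 x h y1 Xx Hh Yy1.
rewrite -(gmulA _ y1) (tY_gone _ Yy1); case: eqP => [j1E|_]; last first.
  by rewrite (lin0 (gmulL _)) (lin0 (gmulR _)) (lin0 rhoL) if_same subr0; case: Wsub.
subst j1; have [lt1|[t1E y1E]] := tY_weight Yy1.
  have Gt1 : G (dot t1) by apply: Gbelow; rewrite -t'l.
  have Wa : W (x ⋆ h ⋆ y1) by rewrite -(tYl Yy1) gmulA; exact: wspan_gone.
  rewrite (rho0 (_ ⋆ y')); last exact: wspan_mulr.
  apply: (submoduleB Wsub); first by case: Wsub.
  by case: ifP => // _; case: Wsub.
subst t1 y1; rewrite -(gmulA x) (tHr Hh) (rho_xhy _ _ _ _ _ _ _ Xx Hh Yy') /g /=.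
case: asboolP => [[i2 [s2 [t2 [j2 /= [Xx2 _ _ Gs2]]]]]|_].
  apply: (submoduleB Wsub); first by case: Wsub.
  case: ifP => _; last by case: Wsub.
  by rewrite -(tXr Xx2); exact: wspan_gone.
case: (eqVneq y y') => [_|_]; last by rewrite andbF subr0; case: Wsub.
rewrite andbT -gmulA -{1}(tHr Hh) -gmulA gone_orth (inj_eq val_inj) eq_sym.
case: eqP => _; last by rewrite !(lin0 (gmulL _)) subr0; case: Wsub.
by rewrite (tHr Hh) subrr; case: Wsub.
Qed.

Variables (Z : choiceType) (i : Z -> idx A) (d : Z -> int).

Definition layer_pred (p : Z * tS T * A) : bool :=
  `[< dot p.1.2 = l /\ tY p.1.2 (i p.1.1) p.2 >].

Definition layer_idx := {p : Z * tS T * A | layer_pred p}.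

(** A degree of a homogeneous element; any degree serves for [0]. *)
Definition elt_deg (y : A) : int := xget 0 [set n | has_degree (ggr A) n y].

Definition layer_i (z : layer_idx) : idx A := val (val z).1.2.
Definition layer_d (z : layer_idx) : int := d (val z).1.1 + elt_deg (val z).2.

Lemma layerP (z : layer_idx) :
  dot (val z).1.2 = l /\ tY (val z).1.2 (i (val z).1.1) (val z).2.
Proof. exact/asboolP/(valP z). Qed.

(** The layer of weight [l] in the direct sum of the [A 1_(i z)] modulo lower
    weights is itself a sum of such modules, one for each [y] of weight [l]. *)
Lemma layer_map : exists Phi : ghom (gfree layer_i layer_d) (gfree i d),
  (forall x, (forall z, W (fcoef (Phi x) z)) <-> (forall z, W (fcoef x z))) /\
  (forall x, (forall z, wspan T (l |` G) (fcoef x z)) <->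
     exists u, forall z, W (fcoef (Phi u - x) z)).
Proof.
have ye (z : layer_idx) : (val z).2 ⋆ gone A (i (val z).1.1) = (val z).2.
  by have [_ Yy] := layerP z; exact: tYr Yy.
pose w z : gfree i d := fsingle d (fun z => gone_deg0 (i z)) (ye z).
have wE z z' : fcoef (w z) z' = if z' == (val z).1.1 then (val z).2 else 0 by [].
have [z|z|Phi PhiE] := @free_hom _ _ layer_idx
  (fun z => gone A (layer_i z)) layer_d (fun z => gone_deg0 (layer_i z)) (gfree i d) w.
- apply: fcoef_inj; apply/funext => z'; rewrite fcoef_act wE.
  have [_ Yy] := layerP z; case: eqP => _; first exact: tYl Yy.
  exact: (lin0 (gmulL _)).
- apply: fcoef_inj; apply/funext => z'; rewrite fcoef_hc wE /=.
  case: eqP => [->|_]; last exact: (lin0 (hcL _ _)).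
  have [_ /tY_sub[_ [n yn]]] := layerP z.
  rewrite /layer_d [d _ + _]addrC addrK.
  exact: (@xgetPex _ 0 [set n | has_degree (ggr A) n (val z).2] (ex_intro _ n yn)).
have PhiZ x r z : uniq r -> (forall z', z' \notin r -> fcoef x z' = 0) ->
    fcoef (Phi x) z = \sum_(z' <- r)
      (if z == (val z').1.1 then fcoef x z' ⋆ (val z').2 else 0).
  move=> ur rx; rewrite (PhiE _ _ ur rx) fcoef_sum; apply: eq_bigr => z' _.
  by rewrite fcoef_act wE; case: eqP => // _; rewrite (lin0 (gmulL _)).
exists Phi; split=> x; have [r [ur rx]] := fsupp_ex x.
  split=> [xW z0|xW z].
    have [tl0 Yy0] := layerP z0.
    have [z0r|/rx->] := boolP (z0 \in r); last by case: Wsub.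
    have [rho [rhoL rho0 rhoW]] := right_division (val z0).1.2 (val z0).2.
    have /rho0 := xW (val z0).1.1.
    rewrite (PhiZ _ _ _ ur rx) (lin_sum rhoL) => rhox.
    have := submodule_sum Wsub r (P := xpredT) (F := fun z' =>
      rho (if (val z0).1.1 == (val z').1.1 then fcoef x z' ⋆ (val z').2 else 0) -
      (if z0 == z' then fcoef x z' else 0)).
    rewrite sumrB rhox sub0r => /(_ _)/(submoduleZ (-1) Wsub).
    rewrite scaleN1r opprK (bigD1_seq z0) //= eqxx big1 ?addr0; last first.
      by move=> z' zz'; rewrite eq_sym (negPf zz').
    apply=> z' _; have [tl' Yy'] := layerP z'.
    case: (eqVneq (val z0).1.1 (val z').1.1) => [z1|z1]; last first.
      rewrite (lin0 rhoL); case: (eqVneq z0 z') => [zz'|_].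
        by move: z1; rewrite zz' eqxx.
      by rewrite subr0; case: Wsub.
    have := rhoW _ _ _ (fcoef x z') tl' Yy' (fcoef_e x z').
    congr (W (_ - (if _ then _ else _))).
    rewrite -[RHS](inj_eq val_inj).
    case: (val z0) (val z') z1 => [[? ?] ?] [[? ?] ?] /= ->.
    by rewrite !xpair_eqE eqxx.
  rewrite (PhiZ _ _ _ ur rx); apply: (submodule_sum Wsub) => z' _.
  by case: ifP => _; [exact: wspan_mulr | case: Wsub].
have GlG : G `<=` l |` G by move=> m; right.
have low' : lower (l |` G).
  move=> a b ba [/= al|Ga]; last by right; exact: Glow ba Ga.
  subst a; move: ba; rewrite le_eqVlt => /predU1P[->|bl]; first by left.
  by right; exact: Gbelow.
have W'sub := wspan_sub T (l |` G).
split=> [xW|[u uW] z]; last first.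
  have -> : fcoef x z = fcoef (Phi u) z - fcoef (Phi u - x) z.
    have -> : fcoef (Phi u - x) z = fcoef (Phi u) z - fcoef x z by [].
    by rewrite opprB addrC subrK.
  apply: (submoduleB W'sub); last exact: (wspan_mono GlG (uW z)).
  have [q [uq qu]] := fsupp_ex u; rewrite (PhiZ _ _ _ uq qu).
  apply: (submodule_sum W'sub) => z' _; case: ifP => _; last by case: W'sub.
  have [t'l Yy'] := layerP z'.
  rewrite -(tYl Yy') gmulA; apply: wspan_gone => //.
  by left.
pose U : set (gfree i d) := [set x | exists u, forall z, W (fcoef (Phi u - x) z)].
have Usub : submodule U.
  split=> [|c v v' [u uW] [u' uW']].
    by exists 0 => z; rewrite ghom0 subrr; case: Wsub.
  exists (c *: u + u') => z; rewrite (hfunL Phi) opprD addrACA -scalerBr fcoefL.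
  by case: Wsub => _; apply.
change (U x); rewrite (fgen_sum (fun z => gone_idem (i z)) ur rx).
apply: (submodule_sum Usub) => z _.
move: (fcoef x z) (xW z) => a; move: a.
apply: (span_ind (U := [set a | U (mact a (ggen i d z))])).
  by apply: submodule_preim; [exact: mactR | exact: Usub].
move=> _ [i' [s [t [j [x' [h [y [Xx Hh Yy Gs ->]]]]]]]].
change (U (mact (x' ⋆ h ⋆ y) (ggen i d z))).
have gen_e : mact (gone A (i z)) (ggen i d z) = ggen i d z by exact: fgen_e.
have -> : mact (x' ⋆ h ⋆ y) (ggen i d z) =
    mact (x' ⋆ h ⋆ (y ⋆ gone A (i z))) (ggen i d z).
  by rewrite gmulA [RHS]mactA gen_e.
rewrite (tY_gone _ Yy).
case: eqP => [jE|_]; last by rewrite (lin0 (gmulL _)) (lin0 (mactR _)); case: Usub.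
subst j; have [sl|Gs'] := Gs; last first.
  exists 0 => z'; rewrite ghom0 sub0r -scaleN1r.
  have -> : fcoef (-1 *: mact (x' ⋆ h ⋆ y) (ggen i d z)) z' =
            -1 *: (x' ⋆ h ⋆ y ⋆ fcoef (ggen i d z) z') by [].
  apply: (submoduleZ _ Wsub); apply: wspan_mulr => //.
  by apply: sub_span; exists i', s, t, (i z), x', h, y.
have zP : layer_pred (z, t, y).
  by apply/asboolP; rewrite /= -(tH_weight Hh).
pose z1 : layer_idx := Sub (z, t, y) zP.
exists (mact (x' ⋆ h) (ggen layer_i layer_d z1)) => z'.
rewrite hfun_act (_ : Phi _ = w z1); last first.
  apply: fcoef_inj; apply/funext => z2.
  rewrite (PhiZ _ [:: z1]) => // [|z3]; last first.
    by rewrite inE => /negPf z13; rewrite fcoef_single z13.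
  rewrite big_seq1 fcoef_single eqxx wE /=; case: eqP => // _.
  by rewrite /layer_i /= (tYl Yy).
have -> : fcoef (mact (x' ⋆ h) (w z1) - mact (x' ⋆ h ⋆ y) (ggen i d z)) z' =
  x' ⋆ h ⋆ fcoef (w z1) z' - x' ⋆ h ⋆ y ⋆ fcoef (ggen i d z) z' by [].
rewrite wE fcoef_single /=; case: eqP => _.
  by rewrite -(gmulA _ y) (tYr Yy) subrr; case: Wsub.
by rewrite !(lin0 (gmulL _)) subr0; case: Wsub.
Qed.

End Step.

(** Each weight of [G] contributes the kernel of one more quotient map, which is
    again of the form considered. *)
Lemma pd_mod_coef G n : filtered G n ->
  forall (Z : choiceType) (i : Z -> idx A) (d : Z -> int) (Q : gmod A)
    (p : ghom (gfree i d) Q), mod_coef (wspan T G) p -> pd n Q.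
Proof.
elim=> [|{}G {}n l Gn IH nGl Gbelow] Z i d Q' p' [p'S p'E].
  apply: (@pd_bij _ _ 0 _ _ p' _ p'S (@gfree_projective _ _ _ i d)).
  apply/ghom_injP => x /p'E xW; apply: fcoef_inj; apply/funext => z.
  exact: wspan0 (xW z).
have Glow := filtered_lower Gn.
have subG (Z' : choiceType) (i' : Z' -> idx A) (d' : Z' -> int) :
    graded_submodule [set x : gfree i' d' | forall z, wspan T G (fcoef x z)].
  apply: coef_submodule.
  - exact: wspan_sub.
  - by move=> a b; exact: wspan_mull.
  - by move=> e a; exact: wspan_hc.
have [Phi [PhiW PhiS]] := layer_map Glow Gbelow i d.
have [Q [p [pS pE]]] := exists_quot (subG _ i d).
have [Q1 [p1 [p1S p1E]]] :=
  exists_quot (subG (@layer_idx l Z i) (@layer_i l Z i) (@layer_d l Z i d)).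
have [x px|r rE] := ghom_factor (f := p') pS.
  by apply/p'E => z; apply: (wspan_mono _ ((pE x).1 px z)) => m; right.
have [x p1x|j jE] := ghom_factor (f := gcomp p Phi) p1S.
  by apply/pE/PhiW/p1E.
have jr : ses j r.
  split.
  - apply/ghom_injP => y; have [x <-] := p1S y.
    by rewrite jE => /pE/PhiW/p1E.
  - by move=> y; have [x <-] := p'S y; exists (p x).
  - move=> y; have [x <-] := pS y; rewrite rE p'E PhiS.
    split=> [[u uW]|[v]].
      exists (p1 u); rewrite jE /=; apply/subr0_eq; rewrite -ghomB.
      exact/pE.
    have [u <-] := p1S v; rewrite jE /= => pu; exists u; apply/pE.
    by rewrite ghomB pu subrr.
apply: (pd_quot jr); first exact: IH (conj p1S p1E).
by apply: pdS; exact: IH (conj pS pE).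
Qed.

End Filtration.

(** * The weight algebras as corners, and opposite algebras *)

Section WeightIdempotents.
Variables (k : fieldType) (A : lugalg k) (disp : Order.disp_t).
Variables (L : porderType disp) (T : triangular_basis A L).
Implicit Types (s t : tS T) (G : set L).

Lemma tS_inj : injective (fun s : tS T => val s : idx A).
Proof. by move=> s t; exact: val_inj. Qed.

Lemma e_weight_seq l : exists q : seq (tS T),
  [/\ uniq q, forall s, s \in q <-> dot s = l &
      e_weight T l = \sum_(s <- q) gone A (val s)].
Proof.
have Fl : finite_set [set s : tS T | dot s = l] := fiber_finite T l.
exists (finmap.enum_fset (fset_set [set s : tS T | dot s = l])); split.
- exact: finmap.fset_uniq.
- by move=> s; rewrite in_fset_set // inE.
- by rewrite /e_weight fsbig_finite.
Qed.

Lemma e_weight_gone s : e_weight T (dot s) ⋆ gone A (val s) = gone A (val s).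
Proof.
have [q [uq qE ->]] := e_weight_seq (dot s).
rewrite (lin_sum (gmulR _)) (bigD1_seq s) //=; last exact/qE.
rewrite gone_idem big1 ?addr0 // => t ts.
by rewrite gone_orth; case: eqP => // /tS_inj ts'; rewrite ts' eqxx in ts.
Qed.

Lemma gone_e_weight s : gone A (val s) ⋆ e_weight T (dot s) = gone A (val s).
Proof.
have [q [uq qE ->]] := e_weight_seq (dot s).
rewrite (lin_sum (gmulL _)) (bigD1_seq s) //=; last exact/qE.
rewrite gone_idem big1 ?addr0 // => t ts.
by rewrite gone_orth; case: eqP => // /tS_inj ts'; rewrite ts' eqxx in ts.
Qed.

Lemma e_weight_wspan G l a b : lower G -> G l ->
  wspan T G (a ⋆ e_weight T l ⋆ b).
Proof.
move=> Gl Gll; have [q [uq qE ->]] := e_weight_seq l.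
rewrite (lin_sum (gmulL _)) (lin_sum (gmulR _)).
apply: (submodule_sum_seq (wspan_sub T G)) => s /qE sl.
by apply: wspan_gone => //; rewrite sl.
Qed.

Variable l : L.

(** The ideal generated by the [e_m] with [l] not below [m] is spanned by the
    basis elements of such weights. *)
Lemma ideal_not_above_wspan a :
  ideal_gen (e_not_above T l) a -> wspan T [set m | ~~ (l <= m)%O] a.
Proof.
have low : lower [set m | ~~ (l <= m)%O].
  move=> p m mp /= lp; apply: contra lp => lm; exact: le_trans lm mp.
apply; split=> [|_ [m lm <-]].
  split; first exact: wspan_sub.
  by move=> b c cW; split; [exact: wspan_mull | exact: wspan_mulr].
by rewrite -(e_weight_idem T m) -{1}(e_weight_idem T m); exact: e_weight_wspan.
Qed.

Variable G : set L.
Hypotheses (Glow : lower G) (nGl : ~ G l) (Gbelow : forall m, (m < l)%O -> G m).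

(** Inside the corner cut out by [e_l], the only weights that occur are at most
    [l]; so killing all weights not above [l] is killing those below [l]. *)
Lemma corner_ideal a :
  ideal_gen (e_not_above T l) (e_weight T l ⋆ a ⋆ e_weight T l) <->
  wspan T G (e_weight T l ⋆ a ⋆ e_weight T l).
Proof.
set e := e_weight T l; have ee : e ⋆ e = e by exact: e_weight_idem.
split=> [/ideal_not_above_wspan aW|].
  have -> : e ⋆ a ⋆ e = e ⋆ (e ⋆ a ⋆ e) ⋆ e.
    by rewrite !gmulA ee -!gmulA ee.
  have [q [uq qE eE]] := e_weight_seq l.
  move: (e ⋆ a ⋆ e) aW.
  apply: (span_ind (U := [set c | wspan T G (e ⋆ c ⋆ e)])).
    exact: (submodule_preim (gmulL e) (submodule_preim (gmulR e) (wspan_sub T G))).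
  move=> _ [i [s [t [j [x [h [y [Xx Hh Yy sl ->]]]]]]]] /=.
  apply: (wspan_mulr _ Glow); rewrite !gmulA; do 2!apply: (wspan_mulr _ Glow).
  rewrite /e eE (lin_sum (gmulR _)).
  apply: (submodule_sum_seq (wspan_sub T G)) => r /qE rl.
  rewrite (gone_tX _ Xx); case: eqP => [iE|_]; last by case: (wspan_sub T G).
  subst i; have [sr|[sE _]] := tX_weight Xx.
    have Gs : G (dot s) by apply: Gbelow; rewrite -rl.
    by have := wspan_gone x (gone A (val s)) Glow Gs; rewrite !(tXr Xx).
  by move: sl; rewrite /= sE rl lexx.
have [Is Im] := ideal_genP (e_not_above T l).
move: (e ⋆ a ⋆ e); apply: (span_ind Is) => _ [i [s [t [j [x [h [y [Xx Hh Yy Gs ->]]]]]]]].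
rewrite -(tXr Xx) -(e_weight_gone s) -!gmulA.
apply: (Im _ _ _).1; apply: (Im _ _ _).2 => U [_]; apply.
exists (dot s) => //=; apply/negP => ls; apply: nGl; exact: Glow ls Gs.
Qed.

Local Notation B := (alg_ge T l).
Local Notation eb := (ebar T l).
Local Notation q := (qpi (ideal_not_above T l)).

Lemma sandwich_mem (a : A) : cmem eb (eb ⋆ (q a : B) ⋆ eb).
Proof.
have ee : eb ⋆ eb = eb by rewrite ebar_idem.
by rewrite /cmem !gmulA ee -!gmulA ee.
Qed.

Definition weight_map (a : A) : alg_weight T l :=
  (Sub _ (sandwich_mem a) : csort eb).

Lemma val_weight_map a : val (weight_map a : csort eb) =
  q (e_weight T l ⋆ a ⋆ e_weight T l).
Proof.
by change (qmul (qmul (q (e_weight T l)) (q a)) (q (e_weight T l)) =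
  q (e_weight T l ⋆ a ⋆ e_weight T l)); rewrite !qmulE.
Qed.

Lemma weight_corner_map : corner_map (e_weight T l) (wspan T G) weight_map.
Proof.
have ee := e_weight_idem T l; have e0 := e_weight_deg0 T l.
have vinj (x y : csort eb) : val x = val y -> x = y by exact: val_inj.
split.
- exact: ee.
- exact: e0.
- move=> c a b; apply: vinj; rewrite val_weight_map.
  change (q (e_weight T l ⋆ (c *: a + b) ⋆ e_weight T l) =
    c *: val (weight_map a : csort eb) + val (weight_map b : csort eb)).
  by rewrite !val_weight_map -[RHS](qpiL (ideal_not_above T l)) gmulL gmulR.
- move=> d a; apply: vinj; rewrite val_weight_map.
  change (q (e_weight T l ⋆ hc (ggr A) d a ⋆ e_weight T l) =
    hc (ggr B) d (val (weight_map a : csort eb))).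
  rewrite val_weight_map [RHS]qhcE hc_corner //.
  by exists 0.
- move=> a b ae; apply: vinj; rewrite val_weight_map.
  change (q (e_weight T l ⋆ (a ⋆ b) ⋆ e_weight T l) =
    (val (weight_map a : csort eb) : B) ⋆ val (weight_map b : csort eb)).
  rewrite !val_weight_map [RHS]qmulE; congr (q _).
  by rewrite !gmulA; do 2!rewrite -(gmulA _ a (e_weight T l)) ae.
- move=> a b eb'; apply: vinj; rewrite val_weight_map.
  change (q (e_weight T l ⋆ (a ⋆ b) ⋆ e_weight T l) =
    (val (weight_map a : csort eb) : B) ⋆ val (weight_map b : csort eb)).
  rewrite !val_weight_map [RHS]qmulE; congr (q _).
  by rewrite !gmulA; do 2!rewrite -(gmulA _ (e_weight T l) b) eb'.
- move=> c; exists (qrepr (val (c : csort eb))); apply: vinj.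
  change (eb ⋆ (q (qrepr (val (c : csort eb))) : B) ⋆ eb = val (c : csort eb)).
  by rewrite qreprK; exact: cmemP.
- move=> a; rewrite -corner_ideal.
  have q0 : q 0 = 0 := lin0 (qpiL _).
  split=> [a0|].
    have : q (e_weight T l ⋆ a ⋆ e_weight T l) = q 0.
      by rewrite -val_weight_map a0 q0.
    by move=> /qpiP; rewrite subr0.
  move=> Ia; apply: vinj; rewrite val_weight_map.
  have -> : val (0 : csort eb) = q 0 by rewrite q0.
  by apply/qpiP; rewrite subr0.
- exists tt; apply: vinj; rewrite val_weight_map !ee.
  by [].
Qed.

End WeightIdempotents.

Lemma corner_map_opp (k : fieldType) (A C : lugalg k) (e : A) (J : set A)
    (phi : A -> C) : corner_map e J phi ->
  @corner_map k (oppalg A) (oppalg C) e J phi.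
Proof.
move=> cm; split.
- exact: cm_idem cm.
- exact: cm_deg0 cm.
- exact: cm_lin cm.
- exact: cm_hc cm.
- by move=> a b ae; exact: (cm_mull cm).
- by move=> a b ae; exact: (cm_mulr cm).
- exact: cm_surj cm.
- by move=> a; rewrite (cm_ker cm) /= gmulA.
- exact: cm_one cm.
Qed.

Section OppositeBasis.
Variables (k : fieldType) (A : lugalg k) (disp : Order.disp_t).
Variables (L : porderType disp) (T : triangular_basis A L).

Local Notation A' := (oppalg A).

Lemma opp_piece (i j : idx A) : @piece k A i j = @piece k A' j i.
Proof.
by apply/seteqP; split=> _ [a _ <-]; exists a => //=; rewrite gmulA.
Qed.

Definition rev_triple (p : A * A * A) : A * A * A := (p.2, p.1.2, p.1.1).

Lemma rev_tripleK : involutive rev_triple.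
Proof. by case=> [[x h] y]. Qed.

Lemma is_basis_reindex (D D' : set (A * A * A)) (f f' : A * A * A -> A) :
  (forall p, D' p -> D (rev_triple p)) -> (forall p, D p -> D' (rev_triple p)) ->
  (forall p, f' p = f (rev_triple p)) -> is_basis D f -> is_basis D' f'.
Proof.
move=> D'D DD' f'E [free gen]; split.
  move=> s c us sD s0 j js.
  have := free (map rev_triple s) (c \o rev_triple) _ _ _ (rev_triple j).
  rewrite /= rev_tripleK; apply.
  - by rewrite map_inj_uniq //; exact: (can_inj rev_tripleK).
  - by move=> _ /= /mapP[p ps ->]; apply: D'D; exact: sD.
  - rewrite big_map -[RHS]s0; apply: eq_bigr => p _.
    by rewrite /= rev_tripleK f'E.
  - exact: map_f.
move=> v; have [s [c [sD ->]]] := gen v.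
exists (map rev_triple s), (c \o rev_triple); split.
  by move=> _ /= /mapP[p ps ->]; apply: DD'; exact: sD.
by rewrite big_map; apply: eq_bigr => p _; rewrite /= f'E rev_tripleK.
Qed.

Definition opp_basis : triangular_basis A' L.
Proof.
refine (@TriangularBasis k A' disp L (tS T : set (idx A')) (@dot _ _ _ _ T)
  (fun (i : idx A') (s : tS T) => @tY _ _ _ _ T s i)
  (fun s t : tS T => @tH _ _ _ _ T t s)
  (fun (t : tS T) (j : idx A') => @tX _ _ _ _ T j t) _ _ _ _ _ _ _ _ _).
- exact: (weight_lower_finite T).
- exact: (@fiber_finite _ _ _ _ T).
- by move=> i s; have := @tY_sub _ _ _ _ T s i; rewrite opp_piece.
- by move=> s t; have := @tH_sub _ _ _ _ T t s; rewrite opp_piece.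
- by move=> t j; have := @tX_sub _ _ _ _ T j t; rewrite opp_piece.
- apply: is_basis_reindex (tA1 T).
  + by move=> p [s [t [Yy Hh Xx]]]; exists t, s.
  + by move=> p [s [t [Xx Hh Yy]]]; exists t, s.
  + by move=> p /=; rewrite gmulA.
- by move=> s; have [XE YE] := @tA2 _ _ _ _ T s.
- move=> s t st; have [X1 H1 Y1] := @tA3 _ _ _ _ T s t st.
  have [X2 H2 Y2] := @tA3 _ _ _ _ T t s (not_eq_sym st).
  split=> //.
  by move=> /H2.
- by move=> i iS; have [X1 Y1] := @tA4 _ _ _ _ T i iS.
Defined.

Lemma wspan_opp G : wspan opp_basis G = wspan T G.
Proof.
congr span; apply/seteqP; split=> a [i [s [t [j [x [h [y [Xx Hh Yy Gs ->]]]]]]]].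
  have Gt : G (dot t) by rewrite -(tH_weight Hh).
  by exists j, t, s, i, y, h, x; split=> //=; rewrite gmulA.
have Gt : G (dot t) by rewrite -(tH_weight Hh).
by exists j, t, s, i, y, h, x; split=> //=; rewrite gmulA.
Qed.

End OppositeBasis.

Section GlobalDimension.
Variables (k : fieldType) (A : lugalg k) (disp : Order.disp_t).
Variables (L : porderType disp) (T : triangular_basis A L).

(** The induction removes the weights of a finite lower set whose ideal contains
    the unit.  It starts from the zero module, and it ends with the empty set,
    for which every module is killed.  The weight algebras enter through corner
    maps, to cover an algebra and its opposite at once. *)
Lemma left_gldim_bounded : unital A ->
    (forall G n l, filtered G n -> ~ G l -> (forall m, (m < l)%O -> G m) ->
       exists (C : lugalg k) (phi : A -> C),
         corner_map (e_weight T l) (wspan T G) phi /\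
         exists m, left_gldim_le C m) ->
  exists n, left_gldim_le A n.
Proof.
move=> [u uE] corner.
have [G [n [Gn uG]]] := wspan_filtered T u.
have top (M : gmod A) : killed (wspan T G) M -> pd 0 M.
  move=> kM; have M0 (v : M) : v = 0.
    have [s _ ->] := mact_sum v; rewrite big1 // => i _.
    by rewrite -(uE (gone A i)).1 mactA kM.
  by move=> X Y g f gS; exists (gzero M X) => x; rewrite [x]M0 !ghom0.
have {top} : exists b, forall M : gmod A, killed (wspan T G) M -> pd b M.
  by exists 0%N.
elim: Gn {uG} => [[b bE]|{}G {}n l Gn IH nGl Gbelow [b bE]].
  exists b => M; apply/pd_projdim_le/bE => a v /wspan0->.
  exact: (lin0 (mactR v)).
apply: IH.
have Glow := filtered_lower Gn.
have [C [phi [cm Cdim]]] := corner G n l Gn nGl Gbelow.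
pose I : choiceType := {s : tS T | `[< dot s = l >]}.
have IE (j : I) : dot (val j) = l by exact/asboolP/(valP j).
apply: (@pd_layer _ _ C (wspan T G) _ _ _ _ (e_weight T l) phi cm I
  (fun j => val (val j)) _ _ _ (maxn n b)) Cdim.
- exact: wspan_sub.
- by move=> a c; exact: wspan_mull.
- by move=> a c; exact: wspan_mulr.
- by move=> d a; exact: wspan_hc.
- by move=> j; have := e_weight_gone (val j); rewrite (IE j).
- by move=> j; have := gone_e_weight (val j); rewrite (IE j).
- have [q [_ qE ->]] := e_weight_seq T l.
  have {qE} : forall s, s \in q -> dot s = l by move=> s /qE.
  elim: q => [|s q IHq] ql; first by exists [::]; rewrite !big_nil.
  have [|r rE] := IHq; first by move=> t tq; apply: ql; rewrite inE tq orbT.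
  have sl : `[< dot s = l >] by apply/asboolP/ql; rewrite inE eqxx.
  by exists (Sub s sl :: r); rewrite !big_cons rE.
- move=> Z i d Q p pQ; apply: (@pd_leq _ _ n); first exact: leq_maxl.
  exact: pd_mod_coef Gn _ _ _ _ _ pQ.
- move=> M kM sM; apply: (@pd_leq _ _ b); first exact: leq_maxr.
  apply: bE; apply: wspan_killed => s [sl|Gs] v.
    have sl' : `[< dot s = l >] by exact/asboolP.
    exact: (sM (Sub s sl')).
  by apply: kM; rewrite -gone_idem -{1}gone_idem; exact: wspan_gone.
Qed.

End GlobalDimension.

Theorem theorem11p6 (k : closedFieldType) (A : lugalg k)
    (disp : Order.disp_t) (L : porderType disp) (T : triangular_basis A L) :
  locally_finite_dimensional A ->
  bounded_below A ->
  unital A ->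
  left_graded_noetherian A ->
  right_graded_noetherian A ->
  (forall l : L, finite_graded_gldim (alg_weight T l)) ->
  finite_graded_gldim A.
Proof.
move=> _ _ uA _ _ dimA.
have [p left_dim] : exists n, left_gldim_le A n.
  apply: (left_gldim_bounded (T := T)) => // G n l Gn nGl Gbelow.
  exists (alg_weight T l), (weight_map T l).
  split; first exact: weight_corner_map (filtered_lower Gn) nGl Gbelow.
  by have [m [? _]] := dimA l; exists m.
have [q right_dim] : exists n, right_gldim_le A n.
  apply: (left_gldim_bounded (T := opp_basis T)).
    by have [u uE] := uA; exists u => a; have [] := uE a.
  move=> G n l Gn nGl Gbelow.
  exists (oppalg (alg_weight T l)), (weight_map T l); split.
    rewrite wspan_opp; apply: corner_map_opp.
    exact: weight_corner_map (filtered_lower Gn) nGl Gbelow.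
  by have [m [_ ?]] := dimA l; exists m.
exists (maxn p q); split=> M; apply: pd_projdim_le.
  by apply: (@pd_leq _ _ p); [exact: leq_maxl | exact/projdim_le_pd/left_dim].
by apply: (@pd_leq _ _ q); [exact: leq_maxr | exact/projdim_le_pd/right_dim].
Qed.
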